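(* Let $(X,\mathcal{F},\mu)$ be a probability space with $L^2(X,\mu)$ infinite dimensional, and let $P$ be a reversible Markov operator on $L^2(X,\mu)$. Then \[ \overline{\lambda}_{\mathrm{ess}}(P)>-1 \iff \inf_{k\geq 1}\overline{h}_P(k)<1. \]
   Context: A Markov operator is a linear operator $P:L^2(X,\mu)\to L^2(X,\mu)$ with $P1=1$ and $Pf\geq 0$ whenever $f\geq 0$; it is reversible (with invariant measure $\mu$) if $\int_X gPf\,d\mu=\int_X fPg\,d\mu$ for all $f,g\in L^2(X,\mu)$. Write $(f,g)_\mu=\int_X fg\,d\mu$ and $1_A$ for the indicator of a measurable set $A$. $\overline{\lambda}_{\mathrm{ess}}(P):=\inf\sigma_{\mathrm{ess}}(P)$ is the infimum of the essential spectrum of $P$. The $k$-way dual Cheeger constant is \[ \overline{h}_P(k):=\sup\min_{1\leq i\leq k}\frac{2(1_{A_{2i-1}},P1_{A_{2i}})_\mu}{\mu(A_{2i-1}\cup A_{2i})}, \] the supremum over all collections of $k$ pairs of measurable sets $(A_1,A_2),\ldots,(A_{2k-1},A_{2k})$ with $A_p\cap A_q=\emptyset$ for all $1\leq p\neq q\leq 2k$ and $\mu(A_{2i-1}\cup A_{2i})>0$ for each $i$. *)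

(* Defs.v *)
From HB Require Import structures.
From mathcomp Require Import all_boot all_order all_algebra.
From mathcomp Require Import all_classical all_reals all_analysis.

Set Implicit Arguments.
Unset Strict Implicit.
Unset Printing Implicit Defensive.
Import Order.TTheory GRing.Theory Num.Theory.
Import numFieldNormedType.Exports.

Local Open Scope classical_set_scope.
Local Open Scope ring_scope.

Section L2defs.
Context {d : measure_display} {T : measurableType d} {R : realType}.
Variable mu : probability T R.

(* Elements of L^2(X,mu) are represented by (measurable, square integrable)
   real functions; two representatives are identified when equal mu-a.e. *)
Definition L2 (f : T -> R) : Prop := f \in Lfun mu 2%:E.

Definition ae_equal (f g : T -> R) : Prop := {ae mu, forall x, f x = g x}.

Definition ip (f g : T -> R) : R := fine (\int[mu]_x (f x * g x)%:E)%E.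

Definition norm2 (f : T -> R) : R := Num.sqrt (ip f f).

Definition fin_spanned (S : set (T -> R)) : Prop :=
  exists (n : nat) (e : 'I_n -> T -> R), (forall i, L2 (e i)) /\
    forall f, S f -> exists c : 'I_n -> R,
      ae_equal f (fun x => \sum_(i < n) c i * e i x).

Definition L2_infinite_dim : Prop := ~ fin_spanned L2.

(* Operators on L^2 are maps on representatives, well defined on a.e.-classes *)
Definition L2_linear_operator (P : (T -> R) -> (T -> R)) : Prop :=
  [/\ forall f, L2 f -> L2 (P f),
      forall f g, L2 f -> L2 g -> ae_equal f g -> ae_equal (P f) (P g) &
      forall (a : R) f g, L2 f -> L2 g ->
        ae_equal (P (fun x => a * f x + g x)) (fun x => a * P f x + P g x)].

Definition markov_operator (P : (T -> R) -> (T -> R)) : Prop :=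
  [/\ L2_linear_operator P,
      ae_equal (P (fun _ => 1)) (fun _ => 1) &
      forall f, L2 f -> {ae mu, forall x, 0 <= f x} ->
        {ae mu, forall x, 0 <= P f x}].

Definition reversible (P : (T -> R) -> (T -> R)) : Prop :=
  forall f g, L2 f -> L2 g -> ip g (P f) = ip f (P g).

Definition fredholm (A : (T -> R) -> (T -> R)) : Prop :=
  [/\ fin_spanned [set f | L2 f /\ ae_equal (A f) (fun _ => 0)],
      (forall (u : nat -> T -> R) (g : T -> R),
         (forall n, L2 (u n)) -> L2 g ->
         (fun n => norm2 (fun x => A (u n) x - g x)) @ \oo --> 0 ->
         exists f, L2 f /\ ae_equal (A f) g) &
      exists (m : nat) (e : 'I_m -> T -> R), (forall i, L2 (e i)) /\
        forall g, L2 g -> exists f (c : 'I_m -> R), L2 f /\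
          ae_equal g (fun x => A f x + \sum_(i < m) c i * e i x)].

(* essential spectrum (real part; P is self-adjoint so sigma_ess(P) is real):
   lambda such that P - lambda I is not Fredholm *)
Definition ess_spectrum (P : (T -> R) -> (T -> R)) : set R :=
  [set lam : R | ~ fredholm (fun f x => P f x - lam * f x)].

Definition lambda_ess_bar (P : (T -> R) -> (T -> R)) : R :=
  inf (ess_spectrum P).

(* admissible collections of k pairs (A_{2i-1}, A_{2i}), i = 1..k,
   encoded as A : nat -> set T using indices 1..2k *)
Definition cheeger_collection (k : nat) (A : nat -> set T) : Prop :=
  (forall p, (1 <= p <= k.*2)%N -> measurable (A p)) /\
  (forall p q, (1 <= p <= k.*2)%N -> (1 <= q <= k.*2)%N -> p <> q ->
     A p `&` A q = set0) /\
  (forall i, (1 <= i <= k)%N -> (0 < mu (A i.*2.-1 `|` A i.*2))%E).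

Definition cheeger_ratio (P : (T -> R) -> (T -> R)) (B C : set T) : R :=
  2 * ip (\1_B) (P (\1_C)) / fine (mu (B `|` C)).

Definition dual_cheeger (P : (T -> R) -> (T -> R)) (k : nat) : \bar R :=
  ereal_sup [set (\big[Order.min/+oo%E]_(1 <= i < k.+1)
                    (cheeger_ratio P (A i.*2.-1) (A i.*2))%:E)%E
            | A in [set A | cheeger_collection k A]].

End L2defs.

(* Main.v *)
Require Import Defs.
From HB Require Import structures.
From mathcomp Require Import all_boot all_order all_algebra.
From mathcomp Require Import all_classical all_reals all_analysis.
From mathcomp Require Import measurable_realfun ring lra zify.

Set Implicit Arguments.
Unset Strict Implicit.
Unset Printing Implicit Defensive.
Import Order.TTheory GRing.Theory Num.Theory.
Import numFieldNormedType.Exports.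

(* Put [A = P + 1] and [Q f = (f, A f)]; then [0 <= Q f <= 2 |f|^2] because [P]
   is a contraction.  Both sides of the equivalence are compared with the
   existence, for all [k] and [eps > 0], of [k] orthonormal functions with
   [Q <= eps].

   If every dual Cheeger constant is at least 1, the functions [1_B - 1_C] built
   from almost optimal pairs form such systems.  They contradict the finite
   codimension of the range of [A]: vectors [g_n] orthogonal to the missing
   directions with [|A g_n|] tiny can be summed to a vector [h] with [(g_n, h)]
   too large.

   If for some [k] and [eps] there is no such system, then, for a maximal one
   [v_1, ..., v_j], the form [Q] is bounded below on the complement of the
   [v_i], so that [A - s] plus a finite rank operator is coercive, hence
   [A - s] is Fredholm, for all small [s].

   It remains to turn a system of [2k] functions into [k] almost bipartite
   pairs.  By density the functions may be taken simple, and [P] becomes a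
   finite weighted graph with a map [F] to R^(2k) that is isotropic and nearly
   odd along the edges.  Isotropy prevents [F] from concentrating near fewer
   than [2k] lines, so one finds [k] separated double cones carrying a mass
   bounded below independently of the graph; composing [F] with odd Lipschitz
   functions supported in these cones gives [k] disjointly supported functions
   with small energy, and a threshold argument extracts a pair from each. *)

Local Open Scope ring_scope.

(** * Semi-inner product spaces *)

(** The discriminant criterion with no sign assumed on [a]: a negative [a] is refuted, and [a = 0]
    forces [b = 0]. *)
Lemma sqr_le_of_quadratic_ge0 (R : realFieldType) (a b c : R) :
  (forall t : R, 0 <= a * t ^+ 2 + 2 * b * t + c) -> b ^+ 2 <= a * c.
Proof.
move=> h.
have [a0|a0|a0] := ltrgt0P a.
- have := h (- b / a).
  have -> : a * (- b / a) ^+ 2 + 2 * b * (- b / a) + c = (a * c - b ^+ 2) / a.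
    by field; rewrite gt_eqF.
  by rewrite pmulr_lge0 ?invr_gt0// subr_ge0.
- have h0 := h 0; have h1 := h ((1 + c + `|b|) / - a + 1).
  (* The values at the two opposite points add up to [2 a (s + 1)^2 + 2 c], and [s] is large enough
     to make this negative. *)
  exfalso; have h2 := h (- ((1 + c + `|b|) / - a + 1)).
  set s := (1 + c + `|b|) / - a in h1 h2.
  have s0 : 0 <= s by rewrite divr_ge0//; have := normr_ge0 b; lra.
  have sa : s * a = - (1 + c + `|b|) by rewrite /s; field; rewrite lt_eqF.
  have : a * (s + 1) ^+ 2 <= a * (s + 1).
    by rewrite ler_wnM2l ?(ltW a0)//; nra.
  have := normr_ge0 b.
  nra.
- rewrite a0 mul0r; have [->|b0] := eqVneq b 0; first by rewrite expr0n.
  have := h (- (c + 1) / (2 * b)); rewrite a0 mul0r add0r.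
  have -> : 2 * b * (- (c + 1) / (2 * b)) + c = -1 by field.
  by lra.
Qed.

Section SemiInnerProduct.
Local Open Scope classical_set_scope.
Context {R : realType} {H : lmodType R} (ip : H -> H -> R).

(** Definiteness is left out because functions are not identified almost everywhere; [f] and [g]
    count as equal when [ip (f - g) (f - g) = 0]. *)
Definition semi_inner_product :=
  [/\ forall f g, ip f g = ip g f,
      forall a f g h, ip (a *: f + g) h = a * ip f h + ip g h &
      forall f, 0 <= ip f f].

Hypothesis hip : semi_inner_product.

Lemma ipC f g : ip f g = ip g f. Proof. by have [+ _ _] := hip; apply. Qed.
Lemma ipZDl a f g h : ip (a *: f + g) h = a * ip f h + ip g h.
Proof. by have [_ + _] := hip; apply. Qed.
Lemma ip_ge0 f : 0 <= ip f f. Proof. by have [_ _] := hip; apply. Qed.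

Lemma ipDl f g h : ip (f + g) h = ip f h + ip g h.
Proof. by rewrite -{1}(scale1r f) ipZDl mul1r. Qed.
Lemma ip0l h : ip 0 h = 0.
Proof. by have := ipDl 0 0 h; rewrite addr0; lra. Qed.
Lemma ipZl a f h : ip (a *: f) h = a * ip f h.
Proof. by rewrite -[a *: f]addr0 ipZDl ip0l addr0. Qed.
Lemma ipNl f h : ip (- f) h = - ip f h.
Proof. by rewrite -scaleN1r ipZl mulN1r. Qed.
Lemma ipBl f g h : ip (f - g) h = ip f h - ip g h.
Proof. by rewrite ipDl ipNl. Qed.
Lemma ipDr f g h : ip h (f + g) = ip h f + ip h g.
Proof. by rewrite !(ipC h) ipDl. Qed.
Lemma ip0r h : ip h 0 = 0. Proof. by rewrite ipC ip0l. Qed.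
Lemma ipZr a f h : ip h (a *: f) = a * ip h f.
Proof. by rewrite !(ipC h) ipZl. Qed.
Lemma ipNr f h : ip h (- f) = - ip h f.
Proof. by rewrite !(ipC h) ipNl. Qed.
Lemma ipBr f g h : ip h (f - g) = ip h f - ip h g.
Proof. by rewrite !(ipC h) ipBl. Qed.
Lemma ip_suml (I : Type) (s : seq I) (Q : pred I) (F : I -> H) h :
  ip (\sum_(i <- s | Q i) F i) h = \sum_(i <- s | Q i) ip (F i) h.
Proof.
by elim/big_rec2 : _ => [|i y1 y2 _ <-]; rewrite ?ip0l// ipDl.
Qed.
Lemma ip_sumr (I : Type) (s : seq I) (Q : pred I) (F : I -> H) h :
  ip h (\sum_(i <- s | Q i) F i) = \sum_(i <- s | Q i) ip h (F i).
Proof. by rewrite ipC ip_suml; apply: eq_bigr => i _; rewrite ipC. Qed.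

Definition ipE := (ipDl, ipDr, ipBl, ipBr, ipZl, ipZr, ipNl, ipNr).

Lemma cauchy_schwarz f g : ip f g ^+ 2 <= ip f f * ip g g.
Proof.
apply: sqr_le_of_quadratic_ge0 => t.
have := ip_ge0 (t *: f + g); rewrite !ipE (ipC g f); congr (0 <= _); ring.
Qed.

Lemma ip_null_l f g h : ip (f - g) (f - g) = 0 -> ip f h = ip g h.
Proof.
move=> e; have := cauchy_schwarz (f - g) h; rewrite e mul0r => le0.
by apply/eqP; rewrite -subr_eq0 -ipBl -sqrf_eq0 eq_le le0 sqr_ge0.
Qed.

Lemma ip_null_r f g h : ip (f - g) (f - g) = 0 -> ip h f = ip h g.
Proof. by rewrite !(ipC h); exact: ip_null_l. Qed.

Lemma ip_ext f g : (forall h, ip f h = ip g h) -> ip (f - g) (f - g) = 0.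
Proof. by move=> e; rewrite ipBl e subrr. Qed.

(** Replaces a vector inside a squared norm by one that is equal only up to a null vector. *)
Lemma ip_ext_sqr f g : (forall h, ip f h = ip g h) -> ip f f = ip g g.
Proof. by move=> e; rewrite e ipC e. Qed.

Lemma ipD_le f g : ip (f + g) (f + g) <= 2 * ip f f + 2 * ip g g.
Proof. by have := ip_ge0 (f - g); rewrite !ipE (ipC g f); lra. Qed.

Lemma pythagoras (I : finType) (v : I -> H) (c e : I -> R) :
  (forall i j, ip (v i) (v j) = (i == j)%:R) ->
  ip (\sum_i c i *: v i) (\sum_i e i *: v i) = \sum_i c i * e i.
Proof.
move=> ov; rewrite ip_suml; apply: eq_bigr => i _.
rewrite ipZl ip_sumr (bigD1 i)//= ipZr ov eqxx mulr1 big1 ?addr0// => j ji.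
by rewrite ipZr ov eq_sym (negbTE ji) mulr0.
Qed.

Lemma ip_sum_le (I : finType) (F : I -> H) :
  ip (\sum_i F i) (\sum_i F i) <= #|I|%:R * \sum_i ip (F i) (F i).
Proof.
have -> : ip (\sum_i F i) (\sum_i F i) = \sum_i \sum_j ip (F i) (F j).
  by rewrite ip_suml; apply: eq_bigr => i _; rewrite ip_sumr.
have -> : #|I|%:R * (\sum_i ip (F i) (F i)) =
    \sum_i \sum_j ((ip (F i) (F i) + ip (F j) (F j)) / 2).
  under [RHS]eq_bigr => i _ do rewrite -mulr_suml big_split/= sumr_const.
  rewrite -mulr_suml big_split/= sumr_const sumrMnl -mulr2n.
  by rewrite -[X in X / 2]mulr_natr mulfK// mulr_natl.
apply: ler_sum => i _; apply: ler_sum => j _.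
by have := ip_ge0 (F i - F j); rewrite !ipE (ipC (F j)); lra.
Qed.

Lemma le_of_cvg0 (a : R) (x : R^nat) :
  x n @[n --> \oo] --> (0 : R) -> (forall n, a <= x n) -> a <= 0.
Proof.
by move=> x0 ax; apply: (ler_cvg_to (cvg_cst a) x0); exact: nearW.
Qed.

(** Only sequences with geometrically decreasing steps are considered: they cover the Richardson
    iteration and the gliding hump, and in L2 they converge without passing to subsequences. *)
Definition geometrically_complete := forall (u : nat -> H) (C r : R),
  0 <= r < 1 ->
  (forall n, ip (u n.+1 - u n) (u n.+1 - u n) <= C * r ^+ n) ->
  exists f, ip (u n - f) (u n - f) @[n --> \oo] --> (0 : R).

(** An operator on representatives respects linear combinations only almost everywhere, so linearity
    is tested against every [h]. *)
Definition linear_up_to_null (B : H -> H) := forall h a f g,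
  ip h (B (a *: f + g)) = a * ip h (B f) + ip h (B g).

Section LinearUpToNull.
Variable B : H -> H.
Hypothesis B_lin : linear_up_to_null B.

Lemma ip_opD h f g : ip h (B (f + g)) = ip h (B f) + ip h (B g).
Proof. by rewrite -{1}(scale1r f) B_lin mul1r. Qed.
Lemma ip_op0 h : ip h (B 0) = 0.
Proof. by have := ip_opD h 0 0; rewrite addr0; lra. Qed.
Lemma ip_opZ h a f : ip h (B (a *: f)) = a * ip h (B f).
Proof. by rewrite -[a *: f]addr0 B_lin ip_op0 addr0. Qed.
Lemma ip_opN h f : ip h (B (- f)) = - ip h (B f).
Proof. by rewrite -scaleN1r ip_opZ mulN1r. Qed.
Lemma ip_opB h f g : ip h (B (f - g)) = ip h (B f) - ip h (B g).
Proof. by rewrite ip_opD ip_opN. Qed.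
Lemma ip_op_sum (I : Type) (s : seq I) (Q : pred I) (F : I -> H) h :
  ip h (B (\sum_(i <- s | Q i) F i)) = \sum_(i <- s | Q i) ip h (B (F i)).
Proof.
by elim/big_rec2 : _ => [|i y1 y2 _ <-]; rewrite ?ip_op0// ip_opD.
Qed.

Lemma coercive_onto (c M : R) (g : H) : geometrically_complete -> 0 < c ->
  0 <= M ->
  (forall f, ip (B f) (B f) <= M * ip f f) ->
  (forall f, c * ip f f <= ip f (B f)) ->
  exists u, ip (B u - g) (B u - g) = 0.
Proof.
(* Richardson iteration [u - t (B u - g)], a contraction for small [t] *)
move=> cpl c0 M0 bdB coB.
(* This [t] gives [t * M <= c], hence the contraction factor [1 - 2 c t + t^2 M <= 1 - c t]; the
   summand [c ^+ 2] keeps [r] nonnegative. *)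
pose M1 := M + c ^+ 2; pose t := c / M1.
have M10 : 0 < M1 by rewrite ltr_wpDl// exprn_gt0.
have t0 : 0 < t by rewrite divr_gt0.
pose r := 1 - c * t.
have tc : t * M1 = c by rewrite /t divfK// gt_eqF.
have r01 : 0 <= r < 1.
  rewrite /r gtrBl mulr_gt0// andbT subr_ge0 mulrA ler_pdivrMr// mul1r.
  by rewrite -expr2 lerDr.
have contr f : ip (f - t *: B f) (f - t *: B f) <= r * ip f f.
  rewrite !ipE (ipC (B f) f); have := bdB f; have := coB f.
  have := ip_ge0 f; have : t * M <= c by rewrite -tc ler_pM2l// lerDl sqr_ge0.
  rewrite /r; set a := ip f f; set b := ip f (B f); set d := ip (B f) (B f).
  move=> h1 h2 h3 h4.
  have : t * (c * a) <= t * b by rewrite ler_pM2l.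
  have : t * (t * d) <= t * (c * a).
    by rewrite ler_pM2l// (le_trans (ler_wpM2l (ltW t0) h4))// mulrA ler_wpM2r.
  by nra.
pose u := fix u n := if n is m.+1 then u m - t *: (B (u m) - g) else 0 : H.
(* Up to null vectors the residual obeys [e n.+1 = e n - t *: B (e n)], so its squared norm decays
   like [r ^+ n]. *)
pose e n := B (u n) - g.
have uS n : u n.+1 - u n = - (t *: e n).
  by rewrite /= addrAC subrr add0r.
have eE m h : ip h (e m) = ip h (B (u m)) - ip h g by rewrite ipBr.
have e_dec n : ip (e n.+1) (e n.+1) <= r * ip (e n) (e n).
  rewrite (@ip_ext_sqr (e n.+1) (e n - t *: B (e n)))// => h.
  rewrite !(ipC _ h) [RHS]ipBr ipZr !eE -[u n.+1](subrK (u n)) uS.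
  by rewrite ip_opD ip_opN ip_opZ; ring.
have e_le n : ip (e n) (e n) <= ip (e 0%N) (e 0%N) * r ^+ n.
  elim: n => [|n IH]; first by rewrite mulr1.
  rewrite exprS mulrCA (le_trans (e_dec n))// ler_wpM2l//.
  by case/andP: r01.
have [|v uv] := cpl u (t ^+ 2 * ip (e 0%N) (e 0%N)) r r01.
  move=> n; rewrite uS (_ : ip _ _ = t ^+ 2 * ip (e n) (e n)); last first.
    by rewrite !ipE; ring.
  by rewrite -mulrA ler_wpM2l ?sqr_ge0.
exists v; apply/eqP; rewrite eq_le ip_ge0 andbT.
have lim0 : 2 * M * ip (u n - v) (u n - v) + 2 * (ip (e 0%N) (e 0%N) * r ^+ n)
    @[n --> \oo] --> (2 * M * 0 + 2 * (ip (e 0%N) (e 0%N) * 0) : R).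
  apply: cvgD; first exact: cvgMr.
  apply: cvgMr; apply: cvgMr; apply: cvg_expr; case/andP: r01 => r0 r1.
  by rewrite ger0_norm.
rewrite !mulr0 addr0 in lim0.
apply: (le_of_cvg0 lim0) => n; have /= := ipD_le (- B (u n - v)) (e n).
rewrite (@ip_ext_sqr (B v - g) (- B (u n - v) + e n)); last first.
  by move=> h; rewrite !(ipC _ h) !ipE ip_opB; ring.
move=> /le_trans; apply; rewrite ipNl ipNr opprK; apply: lerD.
  by rewrite -mulrA ler_pM2l.
by rewrite ler_pM2l.
Qed.
End LinearUpToNull.

End SemiInnerProduct.

(** * Almost bipartite pairs in finite weighted graphs *)

Section Threshold.
Context {R : realType} {V : finType}.

(* Discrete layer-cake: both sides are additive along the superlevel sets of
   [c], so a strict inequality persists at some level. *)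
Lemma exists_superlevel_set (w : V -> V -> R) (a c : V -> R) :
  (forall x, 0 <= c x) ->
  \sum_x a x * c x < \sum_x \sum_y w x y * Num.min (c x) (c y) ->
  exists2 t, 0 <= t & \sum_(x | t < c x) a x <
    \sum_(x | t < c x) \sum_(y | t < c y) w x y.
Proof.
have [n] := ubnP #|[pred x | 0 < c x]|.
elim: n c => // n IH c; rewrite ltnS => cn c0 ac.
have [x0 x0P] : exists x, 0 < c x.
  apply: contrapT => /forallNP h.
  have cz x : c x = 0.
    by apply/eqP; rewrite eq_le c0 andbT leNgt; apply/negP/h.
  move: ac; rewrite big1 => [|x _]; last by rewrite cz mulr0.
  rewrite big1 ?ltxx// => x _.
  by rewrite big1// => y _; rewrite !cz minxx mulr0.
(* Peel off the lowest layer: subtracting the least positive value on the support removes [i] from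
   it, so the induction on its size applies. *)
pose i := [arg min_(i < x0 | 0 < c i) c i]%O.
have [ci iP] : 0 < c i /\ forall j, 0 < c j -> c i <= c j.
  by rewrite /i; case: arg_minP.
pose c' x := if 0 < c x then c x - c i else 0.
have c'0 x : 0 <= c' x by rewrite /c'; case: ifPn => // ?; rewrite subr_ge0 iP.
have cz x : ~~ (0 < c x) -> c x = 0.
  by move=> cx; apply/eqP; rewrite eq_le c0 andbT leNgt.
have cE x : c x = c' x + c i * (0 < c x)%R%:R.
  rewrite /c'; case: ifPn => [_|]; first by rewrite mulr1 subrK.
  by move=> /cz ->; rewrite mulr0 addr0.
have c'n : (#|[pred x | (0 < c' x)%R]| < n)%N.
  apply: (leq_trans _ cn); apply: proper_card; apply/properP; split.
    by apply/fintype.subsetP => x; rewrite !inE /c'; case: ifP; rewrite ?ltxx.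
  by exists i; rewrite !inE// /c' ci subrr ltxx.
have min_split x y : Num.min (c x) (c y) =
    Num.min (c' x) (c' y) + c i * ((0 < c x)%R%:R * (0 < c y)%R%:R).
  rewrite /c'; case: ifPn => cx; case: ifPn => cy.
  - by rewrite mulr1 mulr1 -addr_minl subrK.
  - by rewrite mulr0 mulr0 addr0 (cz _ cy) !min_r// ?subr_ge0 ?iP// ltW.
  - by rewrite mul0r mulr0 addr0 (cz _ cx) !min_l// ?subr_ge0 ?iP// ltW.
  - by rewrite mul0r mulr0 addr0 (cz _ cx) (cz _ cy).
have aE : \sum_x a x * c x =
    \sum_x a x * c' x + c i * \sum_(x | 0 < c x) a x.
  rewrite mulr_sumr [X in _ + X]big_mkcond -big_split/=.
  apply: eq_bigr => x _; rewrite {1}cE mulrDr; congr (_ + _).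
  by case: ifP => _; rewrite ?mulr1 ?mulr0// mulrC.
have wE : \sum_x \sum_y w x y * Num.min (c x) (c y) =
    \sum_x \sum_y w x y * Num.min (c' x) (c' y) +
    c i * \sum_(x | 0 < c x) \sum_(y | 0 < c y) w x y.
  rewrite mulr_sumr [X in _ + X]big_mkcond -big_split/=.
  apply: eq_bigr => x _.
  rewrite (_ : (if _ then _ else _) = \sum_y
      w x y * (c i * ((0 < c x)%R%:R * (0 < c y)%R%:R))).
    by rewrite -big_split/=; apply: eq_bigr => y _; rewrite min_split mulrDr.
  case: ifPn => cx.
    rewrite mulr_sumr big_mkcond/=; apply: eq_bigr => y _.
    by case: ifP => _; rewrite !mul1r ?mulr1 ?mulr0// mulrC.
  by rewrite big1// => y _; rewrite mul0r !mulr0.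
(* Passing to [c'] takes [c i] times the level 0 sums off both sides; if level 0 fails, [c']
   inherits the strict inequality. *)
have [h|h] := ltP (\sum_(x | 0 < c x) a x)
  (\sum_(x | 0 < c x) \sum_(y | 0 < c y) w x y); first by exists 0.
have [|t t0 ht] := IH c' c'n c'0.
  move: ac; rewrite aE wE; have := ler_wpM2l (ltW ci) h.
  set p := c i * _; set q := c i * _; lra.
have eqt x : (t < c' x) = (t + c i < c x).
  rewrite /c'; case: ifPn => cx; first by rewrite ltrBrDr.
  rewrite -leNgt in cx; apply/idP/idP => ?; lra.
exists (t + c i); first by rewrite addr_ge0// ltW.
move: ht; under eq_bigl do rewrite eqt.
by under [X in _ < X]eq_bigl do rewrite eqt; under [X in _ < X]eq_bigr do
  under eq_bigl do rewrite eqt.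
Qed.

Definition mass (p : V -> V -> R) (x : V) : R := \sum_y p x y.

(* The threshold argument of Trevisan for a near [-1]-eigenfunction [phi]. *)
Lemma exists_bipartite_pair (p : V -> V -> R) (phi : V -> R) (eps : R) :
  (forall x y, 0 <= p x y) -> (forall x y, p x y = p y x) -> 0 < eps ->
  \sum_x \sum_y p x y * (phi x + phi y) ^+ 2 <
    eps ^+ 2 * \sum_x mass p x * phi x ^+ 2 ->
  exists A B : {set V}, [/\ [disjoint A & B],
    forall x, x \in A :|: B -> phi x != 0 &
    (1 - eps) * \sum_(x in A :|: B) mass p x <
      2 * \sum_(x in A) \sum_(y in B) p x y].
Proof.
move=> p0 psym eps0 hphi.
(* [o] marks the edges along which [phi] changes sign; only these join the positive and the negative
   half of a superlevel set. *)
pose o x y : R := (phi x * phi y < 0)%R%:R.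
have [t t0] : exists2 t, 0 <= t & \sum_(x | t < phi x ^+ 2) (1 - eps) * mass p x <
    \sum_(x | t < phi x ^+ 2) \sum_(y | t < phi y ^+ 2) p x y * o x y.
  apply: exists_superlevel_set => [x|]; first exact: sqr_ge0.
  have massE (f : V -> R) : \sum_x mass p x * f x =
      \sum_x \sum_y p x y * ((f x + f y) / 2).
    transitivity (\sum_x \sum_y (p x y * f x / 2) +
        \sum_x \sum_y (p x y * f y / 2)).
      rewrite [X in _ + X]exchange_big/= -big_split/=; apply: eq_bigr => x _.
      rewrite -big_split/= /mass mulr_suml; apply: eq_bigr => y _.
      by rewrite (psym y x); field.
    rewrite -big_split/=; apply: eq_bigr => x _; rewrite -big_split/=.
    by apply: eq_bigr => y _; field.
  (* The left side is at most [|a + b| (|a| + |b|) / 2]: for opposite signs it equals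
     [|a^2 - b^2| / 2], otherwise [|a + b| = |a| + |b|]. Young's inequality with weight [eps] then
     separates the two factors. *)
  have pt x y : (phi x ^+ 2 + phi y ^+ 2) / 2 -
      o x y * Num.min (phi x ^+ 2) (phi y ^+ 2) <=
      (phi x + phi y) ^+ 2 / (2 * eps) +
      eps / 2 * ((phi x ^+ 2 + phi y ^+ 2) / 2).
    set a := phi x; set b := phi y.
    have : ((a ^+ 2 + b ^+ 2) / 2 - o x y * Num.min (a ^+ 2) (b ^+ 2)) <=
        `|a + b| * ((`|a| + `|b|) / 2).
      rewrite /o -/a -/b; case: ltP => ab; rewrite ?mul0r ?mul1r.
        have : `|a ^+ 2 - b ^+ 2| <= `|a + b| * (`|a| + `|b|).
          rewrite subr_sqr normrM mulrC ler_wpM2l//.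
          by rewrite (le_trans (ler_normB _ _)).
        case: (leP (a ^+ 2) (b ^+ 2)) => h.
          by rewrite ler0_norm ?subr_le0//; lra.
        by rewrite gtr0_norm ?subr_gt0//; lra.
      have [a0|a0] := leP 0 a; have [b0|b0] := leP 0 b.
      - by rewrite !ger0_norm ?addr_ge0//; nra.
      - have a00 : a = 0 by nra.
        rewrite a00 add0r normr0 add0r (ltr0_norm b0); nra.
      - have b00 : b = 0 by nra.
        rewrite b00 addr0 normr0 addr0 (ltr0_norm a0); nra.
      - by rewrite !ltr0_norm ?addr_lt0//; nra.
    move=> /le_trans; apply.
    have am : `|a + b| * ((`|a| + `|b|) / 2) <= `|a + b| ^+ 2 / (2 * eps) +
        eps / 2 * ((`|a| + `|b|) / 2) ^+ 2.
      rewrite -subr_ge0 (_ : _ - _ =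
        (`|a + b| - eps * ((`|a| + `|b|) / 2)) ^+ 2 / (2 * eps)).
        by rewrite divr_ge0 ?sqr_ge0// mulr_ge0// ltW.
      by field; rewrite gt_eqF.
    rewrite (le_trans am)// real_normK ?num_real// lerD2l.
    apply: ler_wpM2l; first by rewrite divr_ge0// ltW.
    rewrite -(real_normK (num_real a)) -(real_normK (num_real b)).
    have := sqr_ge0 (`|a| - `|b|); have := sqr_ge0 `|a|; have := sqr_ge0 `|b|.
    lra.
  rewrite -subr_gt0.
  have E : \sum_x \sum_y p x y * o x y * Num.min (phi x ^+ 2) (phi y ^+ 2) -
      \sum_x (1 - eps) * mass p x * phi x ^+ 2 >=
      (eps ^+ 2 * (\sum_x mass p x * phi x ^+ 2) -
        \sum_x \sum_y p x y * (phi x + phi y) ^+ 2) / (2 * eps).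
    under [X in _ <= _ - X]eq_bigr do rewrite -mulrA.
    rewrite -mulr_sumr (massE (fun x => phi x ^+ 2)).
    rewrite !mulr_sumr -!sumrB mulr_suml; apply: ler_sum => x _.
    rewrite !mulr_sumr -!sumrB mulr_suml; apply: ler_sum => y _.
    have := ler_wpM2l (p0 x y) (pt x y); move: (p x y) (Num.min _ _) (o x y) => q mm oo.
    move: (phi x) (phi y) => a b.
    rewrite -subr_ge0 => h; rewrite -subr_ge0; move: h; congr (0 <= _).
    by field; rewrite gt_eqF.
  by apply: (lt_le_trans _ E); rewrite divr_gt0 ?subr_gt0// mulr_gt0.
rewrite -mulr_sumr => ht.
pose A := [set x | (t < phi x ^+ 2) && (0 < phi x)].
pose B := [set x | (t < phi x ^+ 2) && (phi x < 0)].
have nz x : t < phi x ^+ 2 -> phi x != 0.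
  by apply: contraTneq => ->; rewrite expr0n/= -leNgt.
have AB x : (x \in A :|: B) = (t < phi x ^+ 2).
  rewrite !inE -andb_orr; apply/andb_idr => /nz.
  by rewrite neq_lt orbC.
have disj : [disjoint A & B].
  rewrite -setI_eq0; apply/eqP/setP => x; rewrite !inE.
  by apply/negP => /andP[/andP[_ h1] /andP[_ h2]]; lra.
exists A, B; split=> //; first by move=> x; rewrite AB => /nz.
(* The sum of [p * o] over the superlevel set is the sum from [A] to [B] plus the sum from [B] to
   [A], which agree by symmetry. *)
rewrite (eq_bigl _ _ AB) (lt_le_trans ht)// le_eqVlt; apply/orP; left; apply/eqP.
have E (f : V -> R) : \sum_(x | t < phi x ^+ 2) f x =
    \sum_(x in A) f x + \sum_(x in B) f x.
  rewrite -bigU//; apply: eq_bigl => x.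
  by rewrite -AB finset.in_setU.
rewrite E; under eq_bigr do rewrite E; under [X in _ + X]eq_bigr do rewrite E.
rewrite mulrDl mul1r; congr (_ + _).
  apply: eq_bigr => x; rewrite inE => /andP[_ x0].
  rewrite big1 ?add0r => [|y]; last first.
    by rewrite inE => /andP[_ y0]; rewrite /o ltNge mulr_ge0 ?mulr0// ltW.
  apply: eq_bigr => y; rewrite inE => /andP[_ y0].
  by rewrite /o pmulr_rlt0// y0 mulr1.
rewrite [RHS]exchange_big/=.
apply: eq_bigr => x; rewrite inE => /andP[_ x0].
rewrite addrC big1 ?add0r => [|y]; last first.
  by rewrite inE => /andP[_ y0]; rewrite /o ltNge nmulr_rge0// ltW// mulr0.
apply: eq_bigr => y; rewrite inE => /andP[_ y0].
by rewrite /o nmulr_rlt0// y0 mulr1 psym.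
Qed.

End Threshold.

Lemma ler_sqr_norm (R : realDomainType) (a b : R) :
  (a ^+ 2 <= b ^+ 2) = (`|a| <= `|b|).
Proof.
rewrite -(real_normK (num_real a)) -(real_normK (num_real b)).
by rewrite ler_sqr ?nnegrE.
Qed.

(** * Separated directions in an isotropic configuration *)

Section Localization.
Context {R : realType} {K : nat}.
Implicit Types u v w : 'rV[R]_K.

Definition dot u v : R := \sum_i u 0 i * v 0 i.

Lemma dot_semi_inner_product : semi_inner_product dot.
Proof.
split.
- by move=> f g; apply: eq_bigr => i _; rewrite mulrC.
- move=> a f g h; rewrite /dot mulr_sumr -big_split/=; apply: eq_bigr => i _.
  by rewrite !mxE; ring.
- by move=> f; apply: sumr_ge0 => i _; rewrite -expr2 sqr_ge0.
Qed.

Let hd := dot_semi_inner_product.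

Definition nrm u : R := Num.sqrt (dot u u).

Lemma nrm_ge0 u : 0 <= nrm u. Proof. exact: sqrtr_ge0. Qed.

Lemma sqr_nrm u : nrm u ^+ 2 = dot u u.
Proof. by rewrite sqr_sqrtr// (ip_ge0 hd). Qed.

Lemma dot_le u v : `|dot u v| <= nrm u * nrm v.
Proof.
rewrite -ler_sqr ?nnegrE ?mulr_ge0 ?nrm_ge0// exprMn !sqr_nrm.
by rewrite real_normK ?num_real// (cauchy_schwarz hd).
Qed.

(** Reverse triangle inequality at [u] and [- v]: the energy controls the sums [F x + F y] along the
    edges. *)
Lemma nrmB_le u v : `|nrm u - nrm v| <= nrm (u + v).
Proof.
rewrite -ler_sqr ?nnegrE ?nrm_ge0// real_normK ?num_real// sqr_nrm.
rewrite (ipDl hd) !(ipDr hd) (ipC hd v u) sqrrB !sqr_nrm.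
have := dot_le u v; rewrite ler_norml => /andP[h _].
by rewrite -!addrA lerD2l !addrA lerD2r; lra.
Qed.

Definition soft_threshold (s b : R) : R :=
  if b < s then s - b else if s < - b then s + b else 0.

(** At nonnegative levels soft thresholding is odd in the first argument and 1-Lipschitz in each, so
    a sum replaces the usual difference. *)
Lemma soft_threshold_lip (s t b c : R) : 0 <= b -> 0 <= c ->
  `|soft_threshold s b + soft_threshold t c| <= `|s + t| + `|b - c|.
Proof.
rewrite /soft_threshold => b0 c0.
have := ler_norm (s + t); have := ler_norm (- (s + t)); rewrite normrN.
have := ler_norm (b - c); have := ler_norm (- (b - c)); rewrite normrN.
move: `|s + t| `|b - c| => P Q *; rewrite ler_norml.
by case: (ltP b s) => ?; case: (ltP c t) => ?; case: (ltP s (- b)) => ?;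
  case: (ltP t (- c)) => ?; apply/andP; split; lra.
Qed.

(* An odd function, homogeneous of degree 1, supported in the double cone
   [|(u, v)| > a |u|], where [a = 19/20].  A unit vector in the cones of both
   [v] and [w] forces [|(v, w)| > 4 a - 3 = 4/5], which is where the separation
   constant below comes from. *)
Definition bump v u : R := soft_threshold (dot u v) (19 / 20 * nrm u).

(** The Lipschitz constants add up to [1 + 19 / 20], at most 2; the factor 4 is the square of 2. *)
Lemma bump_lip v x y : dot v v = 1 ->
  (bump v x + bump v y) ^+ 2 <= 4 * dot (x + y) (x + y).
Proof.
move=> v1; have nv : nrm v = 1 by rewrite /nrm v1 sqrtr1.
have := @soft_threshold_lip (dot x v) (dot y v) (19 / 20 * nrm x)
  (19 / 20 * nrm y).
rewrite -/(bump v x) -/(bump v y) => h.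
have {}h : `|bump v x + bump v y| <= 2 * nrm (x + y).
  apply: le_trans (h _ _) _; try by rewrite mulr_ge0 ?nrm_ge0.
  rewrite -(ipDl hd) -mulrBr normrM (ger0_norm (_ : 0 <= 19 / 20))//.
  have := dot_le (x + y) v; rewrite nv mulr1.
  have := nrmB_le x y; have := nrm_ge0 (x + y); lra.
rewrite -(sqr_nrm (x + y)) -[leLHS]real_normK ?num_real//.
rewrite (_ : 4 = 2 ^+ 2) -?exprMn; last by rewrite expr2; lra.
by rewrite ler_sqr ?nnegrE// mulr_ge0 ?nrm_ge0.
Qed.

Lemma bump_supp v x : bump v x != 0 -> 19 / 20 * nrm x < `|dot x v|.
Proof.
rewrite /bump /soft_threshold; have := nrm_ge0 x => n0.
case: ltP => h; first by rewrite (lt_le_trans h)// ler_norm.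
case: ltP => h2; last by rewrite eqxx.
by rewrite ltr0_norm; lra.
Qed.

Lemma bump_large v x : 39 / 40 * nrm x <= dot x v ->
  40^-1 ^+ 2 * dot x x <= bump v x ^+ 2.
Proof.
move=> h; have n0 := nrm_ge0 x; rewrite -sqr_nrm.
have b : nrm x / 40 <= bump v x.
  rewrite /bump /soft_threshold; case: ltP => h2; first lra.
  by case: ltP => h3; lra.
rewrite -exprMn (mulrC 40^-1).
have n40 : 0 <= nrm x / 40 by rewrite divr_ge0.
by rewrite ler_sqr ?nnegrE// (le_trans n40).
Qed.

Lemma bump_disjoint v w x : dot v v = 1 -> dot w w = 1 ->
  `|dot v w| <= 4 / 5 -> bump v x != 0 -> bump w x = 0.
Proof.
move=> v1 w1 vw /bump_supp xv; apply/eqP/negPn/negP => /bump_supp xw.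
have n0 := nrm_ge0 x.
have np : 0 < nrm x.
  rewrite lt_def n0 andbT; apply/eqP => x0.
  by have := dot_le x v; rewrite x0 mul0r; move: xv; rewrite x0 mulr0; lra.
have sgn (a : R) : exists2 s, s ^+ 2 = 1 & `|a| = s * a.
  have [a0|a0] := leP 0 a; first by exists 1; rewrite ?expr1n// mul1r ger0_norm.
  by exists (-1); rewrite ?sqrrN ?expr1n// mulN1r ltr0_norm.
have [s s2 sE] := sgn (dot x v); have [t t2 tE] := sgn (dot x w).
have st : s * t * dot v w <= 4 / 5.
  rewrite (le_trans (ler_norm _))// !normrM.
  have norm1 (a : R) : a ^+ 2 = 1 -> `|a| = 1.
    move=> a2; apply/eqP; rewrite -(@eqrXn2 _ 2)// real_normK ?num_real//.
    by rewrite a2 expr1n.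
  by rewrite (norm1 s)// (norm1 t)// !mul1r.
(* The signs [s] and [t] make both products positive. The squared norm would then be negative,
   because [6 + 2 * (4 / 5) - 8 * (19 / 20) = 0]. *)
have := ip_ge0 hd ((s * nrm x) *: v + (t * nrm x) *: w - 2 *: x).
rewrite !(ipE hd) v1 w1 (ipC hd v x) (ipC hd w x) (ipC hd w v) -sqr_nrm.
move: xv xw st; rewrite sE tE.
move: (nrm x) np {n0} (dot x v) (dot x w) (dot v w) => n np a b d xv xw st h.
have : 0 <= 6 * n ^+ 2 + 2 * n ^+ 2 * (s * t * d) - 4 * n * (s * a) - 4 * n * (t * b).
  move: h; congr (0 <= _).
  rewrite (_ : 6 = 4 + s ^+ 2 + t ^+ 2); last by rewrite s2 t2; lra.
  by ring.
have := ltr_pM2l np (19 / 20 * n) (s * a); rewrite xv.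
have := ltr_pM2l np (19 / 20 * n) (t * b); rewrite xw.
have n2 : 0 < n ^+ 2 by rewrite exprn_gt0.
have := ler_wpM2l (ltW n2) st.
rewrite !(mulrCA n (19 / 20)) -!expr2 => h1 h2 h3 h4.
lra.
Qed.

Let M := (20 * K).+1.

(** Cubes of side [1 / M] covering [[-1, 1]^K]; the index [2 * M] is there for the endpoint 1. Unit
    vectors in one cube satisfy [|u - v|^2 <= K / M^2 <= 1 / 20], whence the [39 / 40] of
    [cell_close]. *)
Definition cell u : {ffun 'I_K -> 'I_(2 * M).+1} :=
  [ffun i => inord (Num.truncn ((u 0 i + 1) * M%:R))].

Lemma cell_close u v : dot u u = 1 -> dot v v = 1 -> cell u = cell v ->
  39 / 40 <= dot u v.
Proof.
move=> u1 v1 uv.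
have M0 : 0 < M%:R :> R by rewrite ltr0n.
have coord w i : dot w w = 1 -> 0 <= (w 0 i + 1) * M%:R <= 2 * M%:R.
  move=> w1; have : w 0 i ^+ 2 <= 1.
    rewrite -w1 /dot (bigD1 i)//= expr2 lerDl.
    by apply: sumr_ge0 => j _; rewrite -expr2 sqr_ge0.
  rewrite -(expr1n _ 2) ler_sqr_norm normr1 ler_norml => /andP[h1 h2].
  by rewrite mulr_ge0/= ?ler_pM2r//; lra.
have close i : (u 0 i - v 0 i) ^+ 2 <= M%:R^-1 ^+ 2.
  have /andP[a0 a1] := coord u i u1; have /andP[b0 b1] := coord v i v1.
  have tr (a : R) : 0 <= a <= 2 * M%:R -> (Num.truncn a < (2 * M).+1)%N.
    move=> /andP[aa0 aa1]; rewrite ltnS -(ler_nat R) natrM.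
    by rewrite (le_trans _ aa1)// truncn_le.
  have /ffunP/(_ i) := uv; rewrite !ffunE => /(congr1 (@nat_of_ord _)).
  rewrite !inordK ?tr ?coord// => e.
  have := truncn_itv a0; have := truncn_itv b0; rewrite e.
  set n := Num.truncn _ => /andP[b2 b3] /andP[a2 a3].
  rewrite ler_sqr_norm (ger0_norm (_ : 0 <= M%:R^-1)) ?invr_ge0//.
  rewrite -(ler_pM2r M0) mulVf ?gt_eqF// -[X in _ * X](ger0_norm (ltW M0)).
  rewrite -normrM ler_norml; move: a2 a3 b2 b3; rewrite -natr1 => a2 a3 b2 b3.
  by rewrite mulrBl; apply/andP; split; lra.
have : dot (u - v) (u - v) <= 20^-1.
  apply: (@le_trans _ _ (\sum_(i < K) M%:R^-1 ^+ 2)).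
    by apply: ler_sum => i _; rewrite !mxE -expr2 close.
  rewrite sumr_const card_ord -[leLHS]mulr_natl exprVn ler_pdivrMr ?exprn_gt0//.
  rewrite -ler_pdivrMl ?invr_gt0// invrK -natrX -natrM ler_nat /M.
  by rewrite -mulnn (leq_trans (leqnSn _))// leq_pmulr.
rewrite !(ipE hd) u1 v1 (ipC hd v u); lra.
Qed.

Section Greedy.
Context {V : finType} (m : V -> R) (F : V -> 'rV[R]_K).
Hypothesis m0 : forall x, 0 <= m x.
Hypothesis orthonormal_F :
  forall i j, \sum_x m x * (F x 0 i * F x 0 j) = (i == j)%:R.

Lemma isotropy v : \sum_x m x * dot (F x) v ^+ 2 = dot v v.
Proof.
transitivity (\sum_x \sum_i \sum_j v 0 i * v 0 j * (m x * (F x 0 i * F x 0 j))).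
  apply: eq_bigr => x _; rewrite expr2 /dot mulr_suml mulr_sumr.
  apply: eq_bigr => i _; rewrite !mulr_sumr; apply: eq_bigr => j _; ring.
rewrite exchange_big/=; apply: eq_bigr => i _; rewrite exchange_big/=.
under eq_bigr do rewrite -mulr_sumr orthonormal_F.
rewrite (bigD1 i)//= eqxx mulr1 big1 ?addr0// => j ji.
by rewrite eq_sym (negbTE ji) mulr0.
Qed.

Lemma total_mass : \sum_x m x * dot (F x) (F x) = K%:R.
Proof.
under eq_bigr do rewrite /dot mulr_sumr.
rewrite exchange_big/=; under eq_bigr do rewrite orthonormal_F eqxx.
by rewrite sumr_const card_ord.
Qed.

Let N : R := #|{: {ffun 'I_K -> 'I_(2 * M).+1}}|%:R.

(* By isotropy a cap around a previous direction carries mass at most 25/16,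
   so enough mass is left outside of the caps; one of the finitely many cells
   gets a fixed proportion of it. *)
Lemma exists_separated_directions (j : nat) : (2 * j <= K)%N ->
  exists v : nat -> 'rV[R]_K,
    (forall i, (i < j)%N -> dot (v i) (v i) = 1 /\
       40^-1 ^+ 2 / N <= \sum_x m x * bump (v i) (F x) ^+ 2) /\
    (forall i l, (i < j)%N -> (l < j)%N -> i <> l ->
       `|dot (v i) (v l)| <= 4 / 5).
Proof.
elim: j => [_|j IH jK]; first by exists (fun=> 0); split.
have [|v [v1 vv]] := IH; first by rewrite (leq_trans _ jK)// leq_mul.
pose near_old x := [exists i : 'I_j, 4 / 5 * nrm (F x) < `|dot (F x) (v i)|].
have old_mass : \sum_(x | near_old x) m x * dot (F x) (F x) <= 25 / 16 * j%:R.
  apply: (@le_trans _ _ (\sum_x \sum_(i < j) 25 / 16 * (m x * dot (F x) (v i) ^+ 2))).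
    rewrite big_mkcond; apply: ler_sum => x _.
    have ge0 i : 0 <= 25 / 16 * (m x * dot (F x) (v i) ^+ 2).
      by rewrite mulr_ge0// mulr_ge0// sqr_ge0.
    case: ifPn => [/existsP[i hi]|_]; last by apply: sumr_ge0.
    rewrite (bigD1 i)//= ler_wpDr ?sumr_ge0// mulrCA ler_wpM2l// -sqr_nrm.
    have : (4 / 5 * nrm (F x)) ^+ 2 <= dot (F x) (v i) ^+ 2.
      by rewrite ler_sqr_norm ger0_norm ?mulr_ge0 ?nrm_ge0//; exact: ltW.
    by rewrite exprMn; lra.
  rewrite exchange_big/= (eq_bigr (fun=> 25 / 16)) => [|i _].
    by rewrite sumr_const card_ord mulr_natr.
  by rewrite -mulr_sumr isotropy (v1 i _).1// mulr1.
pose u x := (nrm (F x))^-1 *: F x.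
have u1 x : 0 < nrm (F x) -> dot (u x) (u x) = 1.
  move=> n0; rewrite (ipZl hd) (ipZr hd) -sqr_nrm; field.
  by rewrite gt_eqF.
pose S c := \sum_(x | ~~ near_old x && (cell (u x) == c)) m x * dot (F x) (F x).
have N0 : 0 < N.
  by rewrite ltr0n; apply/card_gt0P; exists (cell 0).
(* The mass outside the old caps is at least [2 (j + 1) - 25 / 16 j >= 1], so one of the [N] cells
   holds at least [1 / N]. *)
have [c Sc] : exists c, N^-1 <= S c.
  apply: contrapT => /forallNP h.
  have : \sum_c S c < \sum_(c : {ffun 'I_K -> 'I_(2 * M).+1}) N^-1.
    apply: ltr_sum => [|c _]; first by apply/hasP; exists (cell 0); rewrite ?mem_index_enum.
    by rewrite ltNge; apply/negP/h.
  rewrite sumr_const -mulr_natl divff ?gt_eqF// ltNge => /negP; apply.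
  rewrite /S -(partition_big (fun x => cell (u x)) predT)//=.
  have := total_mass; rewrite (bigID near_old)/=.
  move: jK; rewrite -(ler_nat R) natrM -natr1 => jK.
  have : 0 <= j%:R :> R by [].
  by move: old_mass; lra.
have [x0 [x0old x0c x0n]] : exists x0, [/\ ~~ near_old x0, cell (u x0) = c &
    0 < nrm (F x0)].
  apply: contrapT => /forallNP h; have : 0 < S c.
    by rewrite (lt_le_trans _ Sc)// invr_gt0.
  rewrite /S big1 ?ltxx// => x /andP[xo /eqP xc].
  rewrite -sqr_nrm; have [->|n0] := eqVneq (nrm (F x)) 0.
    by rewrite expr0n mulr0.
  by exfalso; apply: (h x); split=> //; rewrite lt_def n0 nrm_ge0.
(* Points of the cell have cosine at least [39 / 40] with [u x0], so the bump there is at least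
   [(39 / 40 - 19 / 20) |F x| = |F x| / 40]. *)
have newP : 40^-1 ^+ 2 / N <= \sum_x m x * bump (u x0) (F x) ^+ 2.
  apply: (le_trans (ler_wpM2l (sqr_ge0 40^-1) Sc)).
  rewrite mulr_sumr big_mkcond; apply: ler_sum => x _.
  case: ifPn => [/andP[_ /eqP xc]|_]; last by rewrite mulr_ge0// sqr_ge0.
  rewrite mulrCA ler_wpM2l// bump_large//.
  have [nx0|n0] := eqVneq (nrm (F x)) 0.
    have := dot_le (F x) (u x0); rewrite nx0 mulr0 mul0r normr_le0 => /eqP ->.
    by [].
  have np : 0 < nrm (F x) by rewrite lt_def n0 nrm_ge0.
  have := cell_close (u1 _ np) (u1 _ x0n) (etrans xc (esym x0c)).
  by rewrite /u (ipZl hd) ler_pdivlMl// mulrC.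
have sep i : (i < j)%N -> `|dot (u x0) (v i)| <= 4 / 5.
  move=> ij; rewrite (ipZl hd) normrM ger0_norm ?invr_ge0 ?nrm_ge0//.
  rewrite ler_pdivrMl// mulrC; move: x0old; rewrite negb_exists => /forallP.
  by move=> /(_ (Ordinal ij)); rewrite -leNgt.
exists (fun i => if i == j then u x0 else v i); split=> [i|i l]; rewrite ltnS.
  case: (eqVneq i j) => [_ _|ij le]; first by rewrite u1.
  by apply: v1; rewrite ltn_neqAle ij.
move=> ij lj il; case: (eqVneq i j) => [ei|ni]; case: (eqVneq l j) => [el|nl].
- by case: il; rewrite ei el.
- by apply: sep; rewrite ltn_neqAle nl.
- by rewrite (ipC hd); apply: sep; rewrite ltn_neqAle ni.
- by apply: vv => //; rewrite ltn_neqAle ?ni ?nl.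
Qed.

End Greedy.
End Localization.

(** [delta] depends on [k] and [eps] alone: the graph will come from discretising functions, and its
    size is not controlled. The target has dimension [2 k] because the greedy choice yields half as
    many directions. *)
Lemma disjoint_bipartite_pairs (R : realType) (k : nat) (eps : R) : 0 < eps ->
  exists2 delta, 0 < delta & forall (V : finType) (p : V -> V -> R)
    (F : V -> 'rV[R]_(2 * k)),
  (forall x y, 0 <= p x y) -> (forall x y, p x y = p y x) ->
  (forall i j, \sum_x mass p x * (F x 0 i * F x 0 j) = (i == j)%:R) ->
  (forall i, \sum_x \sum_y p x y * (F x 0 i + F y 0 i) ^+ 2 <= delta) ->
  exists A B : 'I_k -> {set V}, [/\ forall i, [disjoint A i & B i],
    forall i j, i != j -> [disjoint A i :|: B i & A j :|: B j] &
    forall i, (1 - eps) * \sum_(x in A i :|: B i) mass p x <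
      2 * \sum_(x in A i) \sum_(y in B i) p x y].
Proof.
move=> eps0.
pose N : R := #|{: {ffun 'I_(2 * k) -> 'I_(2 * (20 * (2 * k)).+1).+1}}|%:R.
have N0 : 0 < N by rewrite ltr0n; apply/card_gt0P; exists (cell (0 : 'rV[R]_(2 * k))).
(* [mu0] bounds the mass of each bump from below, while its energy is at most
   [4 * (2 k) * delta < eps ^+ 2 * mu0]. The 1 in [K1] keeps the denominator positive when
   [k = 0]. *)
pose mu0 : R := 40^-1 ^+ 2 / N.
have mu00 : 0 < mu0 by rewrite divr_gt0// exprn_gt0// invr_gt0.
pose K1 : R := 4 * (2 * k)%N%:R + 1.
have K10 : 0 < K1 by rewrite ltr_wpDl// mulr_ge0.
exists (eps ^+ 2 * mu0 / (2 * K1)).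
  by rewrite divr_gt0// mulr_gt0// exprn_gt0.
move=> V p F p0 psym orthF eF.
have m0 x : 0 <= mass p x by apply: sumr_ge0.
have [v [v1 vv]] := exists_separated_directions m0 orthF (leqnn (2 * k)).
have /choice[AB hAB] : forall i : 'I_k, exists AB : {set V} * {set V},
    [/\ [disjoint AB.1 & AB.2],
    forall x, x \in AB.1 :|: AB.2 -> bump (v i) (F x) != 0 &
    (1 - eps) * \sum_(x in AB.1 :|: AB.2) mass p x <
      2 * \sum_(x in AB.1) \sum_(y in AB.2) p x y].
  move=> i; have [vi1 vimu] := v1 i (ltn_ord i).
  have [|A [B AB]] := @exists_bipartite_pair R V p (fun x => bump (v i) (F x))
    eps p0 psym eps0; last by exists (A, B).
  apply: (@lt_le_trans _ _ (eps ^+ 2 * mu0)); last first.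
    by rewrite ler_wpM2l// sqr_ge0.
  apply: (@le_lt_trans _ _ (\sum_x \sum_y p x y *
      (4 * \sum_j (F x 0 j + F y 0 j) ^+ 2))).
    apply: ler_sum => x _; apply: ler_sum => y _; apply: ler_wpM2l => //.
    rewrite (le_trans (bump_lip _ _ vi1))// ler_wpM2l// /dot.
    by apply: ler_sum => j _; rewrite !mxE expr2.
  have -> : \sum_x \sum_y p x y * (4 * \sum_j (F x 0 j + F y 0 j) ^+ 2) =
      4 * \sum_j \sum_x \sum_y p x y * (F x 0 j + F y 0 j) ^+ 2.
    rewrite [in RHS]exchange_big/= mulr_sumr; apply: eq_bigr => x _.
    rewrite exchange_big/= mulr_sumr; apply: eq_bigr => y _.
    by rewrite mulrCA mulr_sumr.
  apply: (@le_lt_trans _ _ (4 * \sum_(j < 2 * k) eps ^+ 2 * mu0 / (2 * K1))).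
    by rewrite ler_wpM2l//; apply: ler_sum.
  rewrite sumr_const card_ord -[X in 4 * X]mulr_natr.
  have e0 : 0 < eps ^+ 2 * mu0 by rewrite mulr_gt0// exprn_gt0.
  rewrite [ltLHS](_ : _ = eps ^+ 2 * mu0 * (4 * (2 * k)%N%:R / (2 * K1))).
    rewrite -[ltRHS]mulr1 ltr_pM2l// ltr_pdivrMr ?mulr_gt0// mul1r /K1.
    by have : 0 <= (2 * k)%N%:R :> R by []; lra.
  by field; rewrite gt_eqF.
exists (fun i => (AB i).1), (fun i => (AB i).2); split=> [i|i j ij|i].
- by have [] := hAB i.
- rewrite -setI_eq0; apply/eqP/setP => x; rewrite finset.in_setI finset.in_set0.
  apply/negP => /andP[xi xj].
  have [_ /(_ _ xi) bi _] := hAB i; have [_ /(_ _ xj) bj _] := hAB j.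
  move: bj; rewrite (@bump_disjoint _ _ (v i) (v j)) ?eqxx//.
  + by have [] := v1 i (ltn_ord i).
  + by have [] := v1 j (ltn_ord j).
  + by apply: vv => // /val_inj e; rewrite e eqxx in ij.
- by have [] := hAB i.
Qed.

Local Open Scope classical_set_scope.

(** * Fredholm criteria *)

Lemma cvg0_of_sqr (R : realType) (x : R^nat) :
  x n ^+ 2 @[n --> \oo] --> (0 : R) -> x n @[n --> \oo] --> (0 : R).
Proof.
move=> x0; apply/norm_cvg0P; rewrite -(sqrtr0 R).
under eq_fun do rewrite -sqrtr_sqr.
exact: (cvg_comp _ _ x0 (@sqrt_continuous R 0)).
Qed.

(** The row space of [M] is the kernel of [cokermx M], a closed condition; the coefficients [a n]
    themselves may diverge. *)
Lemma row_space_closed (R : realType) (m : nat) (M : 'M[R]_m)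
    (a : nat -> 'rV[R]_m) (b : 'rV[R]_m) :
  (forall j, (a n *m M - b) 0 j @[n --> \oo] --> (0 : R)) ->
  exists x, x *m M = b.
Proof.
move=> ab; suff /submxP[x ->] : (b <= M)%MS by exists x.
rewrite submxE; apply/eqP/rowP => k; rewrite [RHS]mxE.
have E n : (b *m cokermx M) 0 k =
    - \sum_j (a n *m M - b) 0 j * cokermx M j k.
  rewrite -{1}[b](subKr (a n *m M)) mulmxBl -mulmxA mulmx_coker mulmx0 sub0r.
  by rewrite mxE [in LHS]mxE.
have lim : - \sum_j (a n *m M - b) 0 j * cokermx M j k @[n --> \oo] -->
    (- \sum_(j < m) 0 * cokermx M j k : R).
  apply: cvgN; apply: cvg_big => [|j _]; first exact: add_continuous; exact: cvgMl.
rewrite big1 ?oppr0 in lim; last by move=> *; rewrite mul0r.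
have {}lim : (b *m cokermx M) 0 k @[n --> \oo] --> (0 : R).
  by apply: cvg_trans lim; apply: near_eq_cvg; apply: nearW => n; rewrite -E.
exact: (cvg_unique _ (@cvg_cst _ _ _ _ _) lim).
Qed.

Section Fredholm.
Context {R : realType} {H : lmodType R} (ip : H -> H -> R).
Hypothesis hip : semi_inner_product ip.
Hypothesis cpl : geometrically_complete ip.

(** [fredholm] on the space of representatives, with almost everywhere equality turned into a null
    difference; [fredholm_of_shift] translates back. *)
Definition fredholm_op (B : H -> H) :=
  [/\ exists n (e : 'I_n -> H), forall f, ip (B f) (B f) = 0 ->
        exists c : 'I_n -> R,
          ip (f - \sum_i c i *: e i) (f - \sum_i c i *: e i) = 0,
      forall u g, ip (B (u n) - g) (B (u n) - g) @[n --> \oo] --> (0 : R) ->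
        exists f, ip (B f - g) (B f - g) = 0 &
      exists m (e : 'I_m -> H), forall g, exists f (c : 'I_m -> R),
        ip (g - (B f + \sum_i c i *: e i)) (g - (B f + \sum_i c i *: e i)) = 0].

(** The finite rank perturbation [B'] is invertible up to null vectors, with [w i] the preimage of
    [v i]. Hence the kernel of [B] lies in the span of the [w i], and the [v i] complete its
    range. *)
Lemma coercive_finite_rank_fredholm (B : H -> H) (n : nat) (v : 'I_n -> H)
    (c M : R) : linear_up_to_null ip B -> 0 < c -> 0 <= M ->
  (forall f, ip (B f) (B f) <= M * ip f f) ->
  (forall f, c * ip f f <= ip f (B f) + \sum_i ip f (v i) ^+ 2) ->
  fredholm_op B.
Proof.
move=> B_lin c0 M0 bdB coB.
pose F f := \sum_i ip f (v i) *: v i.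
pose B' f := B f + F f.
have ipF h f : ip h (F f) = \sum_i ip f (v i) * ip h (v i).
  by rewrite (ip_sumr hip); apply: eq_bigr => i _; rewrite (ipZr hip).
have ipB' h f : ip h (B' f) = ip h (B f) + ip h (F f) by rewrite (ipDr hip).
have B'_lin : linear_up_to_null ip B'.
  move=> h a f g; rewrite !ipB' B_lin !ipF mulrDr mulr_sumr addrACA -big_split/=.
  congr (_ + _); apply: eq_bigr => i _.
  by rewrite (ipZDl hip); ring.
have [M' M'0 bdB'] : exists2 M', 0 <= M' &
    forall f, ip (B' f) (B' f) <= M' * ip f f.
  exists (2 * M + 2 * (n%:R * \sum_i ip (v i) (v i) ^+ 2)).
    rewrite addr_ge0 ?mulr_ge0 ?sumr_ge0// => i _; exact: sqr_ge0.
  move=> f; rewrite (le_trans (ipD_le hip _ _))// [leRHS]mulrDl -![in leRHS]mulrA lerD//.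
    by rewrite ler_pM2l.
  rewrite ler_pM2l// (le_trans (ip_sum_le hip _))// card_ord ler_wpM2l//.
  rewrite mulr_suml; apply: ler_sum => i _; rewrite (ipZl hip) (ipZr hip).
  have := ler_wpM2r (ip_ge0 hip (v i)) (cauchy_schwarz hip f (v i)).
  by congr (_ <= _); ring.
have coB' f : c * ip f f <= ip f (B' f).
  by rewrite ipB' ipF; under eq_bigr do rewrite -expr2.
have onto g : exists u, ip (B' u - g) (B' u - g) = 0.
  exact: (coercive_onto hip B'_lin g cpl c0 M'0 bdB' coB').
have inj f : c ^+ 2 * ip f f <= ip (B' f) (B' f).
  have := coB' f; have := cauchy_schwarz hip f (B' f).
  have := ip_ge0 hip f; have := ip_ge0 hip (B' f).
  set x := ip f f; set y := ip _ _; set z := ip _ _ => y0 x0 h1 h2.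
  have [x_eq0|xn0] := eqVneq x 0; first by rewrite x_eq0 mulr0.
  have xp : 0 < x by rewrite lt_def xn0.
  have cx0 : 0 <= c * x by rewrite mulr_ge0 ?ltW.
  have : (c * x) ^+ 2 <= z ^+ 2 by rewrite ler_sqr ?nnegrE// (le_trans cx0).
  move=> /le_trans/(_ h1); by rewrite exprMn (expr2 x) mulrA mulrC ler_pM2l.
have /choice[w hw] : forall i : 'I_n, exists u, ip (B' u - v i) (B' u - v i) = 0.
  by move=> i; exact: onto.
(* [B'] sends [sum_i a i *: w i] to [sum_i a i *: v i]. *)
have key f (a : 'I_n -> R) h :
    ip h (B' (f - \sum_i a i *: w i)) = ip h (B f) + ip h (F f) -
      \sum_i a i * ip h (v i).
  rewrite (ip_opB B'_lin) ipB' (ip_op_sum B'_lin); congr (_ - _).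
  apply: eq_bigr => i _; rewrite (ip_opZ B'_lin).
  by rewrite (ip_null_r hip _ (hw i)).
split.
- exists n, w => f Bf0; exists (fun i => ip f (v i)).
  apply/eqP; rewrite eq_le (ip_ge0 hip) andbT.
  rewrite -(pmulr_rle0 _ (exprn_gt0 2 c0)) (le_trans (inj _))//.
  rewrite (@ip_ext_sqr _ _ _ hip _ 0) ?(ip0l hip)// => h.
  rewrite (ipC hip _ h) key (ip0l hip) ipF (ipC hip h).
  by rewrite -[B f](subr0) in Bf0; rewrite (ip_null_l hip _ Bf0) (ip0l hip); ring.
(* [B'] maps [z k] to [B (u k) - g], so [z k] tends to 0 and [a k *m (1%:M - W)] tends to [b]. A
   solution [x] of the limiting system gives [f = y + \sum_i x 0 i *: w i], whose pairings with the
   [v j] are the entries of [x]; thus [B f = g] up to a null vector. *)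
- move=> u g Bug; have [y hy] := onto g.
  pose a k : 'rV[R]_n := \row_i ip (u k) (v i).
  pose z k := u k - y - \sum_i a k 0 i *: w i.
  have z_le k : c ^+ 2 * ip (z k) (z k) <= ip (B (u k) - g) (B (u k) - g).
    rewrite (le_trans (inj _))//.
    rewrite (@ip_ext_sqr _ _ _ hip _ (B (u k) - g))// => h.
    rewrite !(ipC hip _ h) /z -addrA [- y - _]addrC addrA.
    rewrite (ip_opB B'_lin) key (ip_null_r hip _ hy) ipF (ipBr hip).
    under [X in _ - X - _]eq_bigr do rewrite mxE.
    by ring.
  pose W : 'M[R]_n := \matrix_(i, j) ip (w i) (v j).
  pose b : 'rV[R]_n := \row_j ip y (v j).
  have zE k j : ip (z k) (v j) = (a k *m (1%:M - W) - b) 0 j.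
    rewrite /z 2!(ipBl hip) (ip_suml hip) mulmxBr mulmx1 !mxE addrAC.
    congr (_ - _ - _); apply: eq_bigr => i _.
    by rewrite !mxE (ipZl hip).
  have [|x xb] := @row_space_closed R n (1%:M - W) a b.
    move=> j; under eq_fun do rewrite -zE.
    apply: cvg0_of_sqr.
    apply: (@squeeze_cvgr _ _ _ _ (fun=> 0)
      (fun k => c ^- 2 * ip (v j) (v j) * ip (B (u k) - g) (B (u k) - g))).
    + apply: nearW => k; rewrite sqr_ge0/= (le_trans (cauchy_schwarz hip _ _))//.
      rewrite mulrAC ler_wpM2r ?(ip_ge0 hip)//.
      by rewrite ler_pdivlMl ?exprn_gt0.
    + exact: cvg_cst.
    + rewrite -[X in _ --> X](mulr0 (c ^- 2 * ip (v j) (v j))).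
      exact: cvgMr.
  pose f := y + \sum_i x 0 i *: w i.
  have fv j : ip f (v j) = x 0 j.
    rewrite (ipDl hip) (ip_suml hip).
    have /rowP/(_ j) := xb; rewrite mulmxBr mulmx1 !mxE => <-.
    rewrite -[RHS]addr0 -addrA; congr (_ + _); apply/eqP.
    rewrite addrC subr_eq0; apply/eqP; apply: eq_bigr => i _.
    by rewrite !mxE (ipZl hip).
  exists f; apply: (ip_ext hip) => h; rewrite !(ipC hip _ h).
  have := key f (fun i => x 0 i) h; rewrite /f addrK (ip_null_r hip _ hy) -/f => ->.
  rewrite ipF; under [X in _ + X - _]eq_bigr do rewrite fv.
  by rewrite addrK.
- exists n, v => g; have [u hu] := onto g.
  exists u, (fun i => ip u (v i)); apply: (ip_ext hip) => h.
  by rewrite (ip_null_l hip _ hu).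
Qed.

End Fredholm.

(** * Near-kernel systems obstruct finite codimension of the range *)

Lemma exists_left_kernel (F : fieldType) (m : nat) (E : 'M[F]_(m.+1, m)) :
  exists2 c : 'rV[F]_m.+1, c != 0 & c *m E = 0.
Proof.
exists (nz_row (kermx E)); last by apply: sub_kermxP; exact: nz_row_sub.
rewrite nz_row_eq0 -mxrank_eq0 mxrank_ker -lt0n subn_gt0.
by rewrite (leq_ltn_trans (rank_leq_col _)).
Qed.

Section NearKernel.
Context {R : realType} {H : lmodType R} (ip : H -> H -> R).
Hypothesis hip : semi_inner_product ip.
Hypothesis cpl : geometrically_complete ip.

Definition near_kernel_system (A : H -> H) (k : nat) (eps : R)
    (f : 'I_k -> H) :=
  (forall i j, ip (f i) (f j) = (i == j)%:R) /\
  (forall i, ip (f i) (A (f i)) <= eps).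

Variable A : H -> H.
Hypothesis A_lin : linear_up_to_null ip A.
Hypothesis A_sym : forall f g, ip f (A g) = ip g (A f).
Hypothesis A_ge0 : forall f, 0 <= ip f (A f).
Hypothesis A_le2 : forall f, ip f (A f) <= 2 * ip f f.

(** Makes Cauchy-Schwarz and its consequences available for the form of [A]. *)
Lemma quadratic_form_semi_inner_product :
  semi_inner_product (fun f g => ip f (A g)).
Proof. by split=> // *; rewrite (ipZDl hip). Qed.

Let hq := quadratic_form_semi_inner_product.

(** Cauchy-Schwarz for the form of [A] at [A f] and [f] bounds [|A f|^4] by [(A f, A A f) (f, A f)
    <= 2 |A f|^2 (f, A f)]. *)
Lemma norm_op_le f : ip (A f) (A f) <= 2 * ip f (A f).
Proof.
have := cauchy_schwarz hq (A f) f; rewrite /= mulrC => h.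
have [->|x0] := eqVneq (ip (A f) (A f)) 0; first by rewrite mulr_ge0.
have xp : 0 < ip (A f) (A f) by rewrite lt_def x0 (ip_ge0 hip).
rewrite -(ler_pM2r xp) -expr2 (le_trans h)// [leRHS]mulrAC mulrC.
by rewrite ler_wpM2r.
Qed.

(** Among [m.+1] vectors of a system some nonzero combination is orthogonal to all [m] vectors
    [e i]. *)
Lemma near_kernel_perp (m : nat) (e : 'I_m -> H) (eps : R) :
  (forall k delta, 0 < delta -> exists f, @near_kernel_system A k delta f) ->
  0 < eps ->
  exists g, [/\ ip g g = 1, forall i, ip g (e i) = 0 & ip (A g) (A g) <= eps].
Proof.
move=> sys eps0.
(* The factor [m.+1] is lost in [ip_sum_le] and the factor 2 in [norm_op_le]. *)
have d0 : 0 < eps / (2 * m.+1%:R) by rewrite divr_gt0// mulr_gt0.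
have [f [of_ qf]] := sys m.+1 _ d0.
have [c c0 cE] := exists_left_kernel (\matrix_(i < m.+1, j < m) ip (f i) (e j)).
pose s := \sum_i c 0 i ^+ 2.
have s0 : 0 < s.
  rewrite lt_def sumr_ge0 ?andbT => [|i _]; last exact: sqr_ge0.
  apply: contra c0; rewrite psumr_eq0 => [/allP h|i _]; last exact: sqr_ge0.
  apply/eqP/rowP => i; rewrite mxE; apply/eqP; rewrite -sqrf_eq0.
  by apply: h; rewrite mem_index_enum.
pose g0 := \sum_i c 0 i *: f i.
have g00 : ip g0 g0 = s.
  by rewrite (pythagoras hip)//; apply: eq_bigr => i _; rewrite expr2.
pose g := (Num.sqrt s)^-1 *: g0.
have ss : (Num.sqrt s)^-1 ^+ 2 = s^-1 by rewrite exprVn sqr_sqrtr ?ltW.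
exists g; split.
- rewrite (ipZl hip) (ipZr hip) mulrA -expr2 g00 ss mulVf//.
  by rewrite gt_eqF.
- move=> j; rewrite (ipZl hip) (ip_suml hip).
  have /rowP/(_ j) := cE; rewrite !mxE => h.
  rewrite (_ : \sum_i _ = 0) ?mulr0// -[RHS]h; apply: eq_bigr => i _.
  by rewrite mxE (ipZl hip).
- rewrite (le_trans (norm_op_le _))// (ipZl hip) (ip_opZ A_lin).
  rewrite mulrA -expr2 ss mulrCA -ler_pdivlMl ?invr_gt0// invrK.
  rewrite -ler_pdivlMl// (le_trans (ip_sum_le hq _))//= card_ord.
  rewrite -ler_pdivlMl// /s mulr_suml mulr_sumr mulr_sumr.
  apply: ler_sum => i _; rewrite (ipZl hip) (ip_opZ A_lin) mulrA -expr2.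
  have := ler_wpM2l (sqr_ge0 (c 0 i)) (qf i).
  move=> /le_trans; apply; rewrite le_eqVlt; apply/orP; left; apply/eqP.
  by field.
Qed.

(* Sokal's gliding hump: [h = sum_n +-3^-n g_n] with the signs chosen so that
   [|ip (g n) h| >= 3^-n / 2], which is incompatible with [h] lying in the
   range of [A] plus the span of [e]. *)
Lemma near_kernel_not_cofinite (m : nat) (e : 'I_m -> H) :
  (forall k delta, 0 < delta -> exists f, @near_kernel_system A k delta f) ->
  ~ (forall g, exists f (c : 'I_m -> R),
      ip (g - (A f + \sum_i c i *: e i)) (g - (A f + \sum_i c i *: e i)) = 0).
Proof.
move=> sys cof.
(* The bound [9^-n] on [|A (g n)|] has to beat the coefficients [3^-n] of [h]. *)
have /choice[g hg] : forall n : nat, exists g, [/\ ip g g = 1,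
    forall i, ip g (e i) = 0 & ip (A g) (A g) <= 81^-1 ^+ n].
  by move=> n; apply: near_kernel_perp => //; rewrite exprn_gt0.
pose s n (h : H) : R := if 0 <= ip (g n) h then 1 else -1.
pose h := fix h n := if n is k.+1 then h k + (s k (h k) * 3^-1 ^+ k) *: g k
                     else 0 : H.
have hSE n : h n.+1 = h n + (s n (h n) * 3^-1 ^+ n) *: g n by [].
have hS n : h n.+1 - h n = (s n (h n) * 3^-1 ^+ n) *: g n.
  by rewrite hSE addrC addKr.
have s2 n k : s n k ^+ 2 = 1 by rewrite /s; case: ifP => _; rewrite ?sqrrN expr1n.
have sn n k : `|s n k| = 1 by rewrite /s; case: ifP => _; rewrite ?normrN normr1.
have p3 n : 0 < 3^-1 ^+ n :> R by rewrite exprn_gt0.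
have [|n|x hx] := cpl (u := h) (C := 1) (r := 9^-1).
- by apply/andP; split; lra.
- have [g1 _ _] := hg n.
  rewrite hS (ipZl hip) (ipZr hip) g1 mulr1 -expr2 exprMn s2 !mul1r.
  by rewrite exprAC expr2 -invfM -natrM.
have g_le n k y : `|ip (g n) (y *: g k)| <= `|y|.
  rewrite (ipZr hip) normrM ler_piMr// -ler_sqr ?nnegrE// expr1n.
  rewrite real_normK ?num_real// (le_trans (cauchy_schwarz hip _ _))//.
  by have [-> _ _] := hg n; have [-> _ _] := hg k; rewrite mulr1.
have low n : 3^-1 ^+ n <= `|ip (g n) (h n.+1)|.
  have [g1 _ _] := hg n.
  rewrite hSE (ipDr hip) (ipZr hip) g1 mulr1 /s; have := p3 n.
  move: (3^-1 ^+ n) (ip (g n) (h n)) => q a.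
  case: (leP 0 a) => h0 h1; rewrite ?mul1r ?mulN1r.
    rewrite ger0_norm; lra.
  rewrite ltr0_norm; lra.
(* The right side is the sum of [3^-j] over [n < j <= n + k]; its limit [3^-n / 2] is half of what
   [low] provides. *)
have tail n k : `|ip (g n) (h (n.+1 + k)%N) - ip (g n) (h n.+1)| <=
    (3^-1 ^+ n - 3 * 3^-1 ^+ (n.+1 + k)) / 2.
  elim: k => [|k IH]; first by rewrite addn0 subrr normr0 exprS; lra.
  rewrite addnS hSE (ipDr hip) addrAC; apply: (le_trans (ler_normD _ _)).
  apply: (le_trans (lerD IH (g_le _ _ _))); rewrite normrM sn mul1r.
  by rewrite (ger0_norm (ltW (p3 _))) [in leRHS]exprS; lra.
have gx n : 3^-1 ^+ n / 2 <= `|ip (g n) x|.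
  have lim : `|ip (g n) (h (n.+1 + k)%N - x)| @[k --> \oo] --> (0 : R).
    apply/norm_cvg0P; apply: cvg0_of_sqr.
    apply: (@squeeze_cvgr _ _ _ _ (fun=> 0)
      (fun k => ip (h (n.+1 + k)%N - x) (h (n.+1 + k)%N - x))).
    + apply: nearW => k; rewrite sqr_ge0/= (le_trans (cauchy_schwarz hip _ _))//.
      by have [-> _ _] := hg n; rewrite mul1r.
    + exact: cvg_cst.
    + have := hx; rewrite -(cvg_shiftn n.+1) /=.
      by under eq_fun do rewrite addnC.
  have := le_of_cvg0 (a := 3^-1 ^+ n / 2 - `|ip (g n) x|) lim.
  rewrite subr_le0; apply => k; rewrite (ipBr hip).
  have := tail n k; have := low n; have := p3 (n.+1 + k)%N.
  set a := ip _ (h _); set b := ip _ (h _); set y := ip _ x.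
  have := ler_normD (b - a) (a - y); have := ler_normD (b - y) y.
  have := ler_normD (- (b - a)) b; rewrite normrN !subrK opprB subrK.
  have := ler_normD (a - y) y; rewrite subrK.
  by move=> *; lra.
have [f [c xf]] := cof x.
(* [g n] is orthogonal to the [e i], so pairing it with [x = A f + \sum_i c i *: e i] leaves
   [(A (g n), f)]. With [gx] this yields [9 ^+ n <= 4 |f|^2] for every [n]. *)
have up n : (3^-1 ^+ n / 2) ^+ 2 <= 81^-1 ^+ n * ip f f.
  have [g1 ge gA] := hg n.
  rewrite (le_trans (y := ip (A (g n)) f ^+ 2))//.
    rewrite (_ : ip (A (g n)) f = ip (g n) x).
      have x0 : 0 <= 3^-1 ^+ n / 2 :> R by rewrite divr_ge0 ?ltW.
      by rewrite -[leRHS]real_normK ?num_real// ler_sqr ?nnegrE// gx.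
    rewrite (ip_null_r hip _ xf) (ipDr hip) (ip_sumr hip) big1 ?addr0.
      by rewrite (ipC hip) A_sym.
    by move=> i _; rewrite (ipZr hip) ge mulr0.
  by rewrite (le_trans (cauchy_schwarz hip _ _))// ler_wpM2r// (ip_ge0 hip).
have big n : 9 ^+ n <= 4 * ip f f.
  have := up n; rewrite exprMn -exprM mulnC exprM.
  rewrite (_ : 3^-1 ^+ 2 = 9^-1 :> R); last by field.
  rewrite (_ : 81^-1 = 9^-1 * 9^-1 :> R); last by field.
  rewrite exprMn -mulrA ler_pM2l ?exprn_gt0// => h1.
  have : 9 ^+ n * (2^-1 ^+ 2) <= 9 ^+ n * (9^-1 ^+ n * ip f f) :> R.
    by rewrite ler_pM2l// exprn_gt0.
  by rewrite mulrA -exprMn mulfV// expr1n mul1r; lra.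
have nat_le n : n%:R <= 9 ^+ n :> R.
  by rewrite -natrX ler_nat ltnW// ltn_expl.
have := big (Num.truncn (4 * ip f f)).+1; apply/negP; rewrite -ltNge.
by rewrite (lt_le_trans (truncnS_gt _)).
Qed.

End NearKernel.

Section NormConvergence.
Context {R : realType} {H : lmodType R} (ip : H -> H -> R).
Hypothesis hip : semi_inner_product ip.

Lemma cvg_ip (h f : H) (u : nat -> H) :
  ip (f - u n) (f - u n) @[n --> \oo] --> (0 : R) ->
  ip h (u n) @[n --> \oo] --> ip h f.
Proof.
move=> uf; suff lim : ip h (f - u n) @[n --> \oo] --> (0 : R).
  rewrite -[X in _ --> X]subr0.
  have -> : (fun n => ip h (u n)) = (fun n => ip h f - ip h (f - u n)).
    by apply/funext => n; rewrite (ipBr hip) subKr.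
  by apply: cvgB => //; exact: cvg_cst.
apply: cvg0_of_sqr; apply: (@squeeze_cvgr _ _ _ _ (fun=> 0)
    (fun n => ip h h * ip (f - u n) (f - u n))).
- by apply: nearW => n; rewrite sqr_ge0/= (cauchy_schwarz hip).
- exact: cvg_cst.
- by rewrite -[X in _ --> X](mulr0 (ip h h)); exact: cvgMr.
Qed.

Lemma cvg_ip_sqr (f : H) (u : nat -> H) :
  ip (f - u n) (f - u n) @[n --> \oo] --> (0 : R) ->
  ip (u n) (u n) @[n --> \oo] --> ip f f.
Proof.
move=> uf; have -> : (fun n => ip (u n) (u n)) =
    (fun n => ip (f - u n) (f - u n) + 2 * ip f (u n) - ip f f).
  by apply/funext => n; rewrite !(ipE hip) (ipC hip (u n) f); ring.
rewrite [X in _ --> X](_ : _ = 0 + 2 * ip f f - ip f f); last by ring.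
by apply: cvgB; [apply: cvgD => //; apply: cvgMr; exact: cvg_ip|exact: cvg_cst].
Qed.

End NormConvergence.

(** * Fredholm property of the shifted operators *)

Section SpectralGap.
Context {R : realType} {H : lmodType R} (ip : H -> H -> R).
Hypothesis hip : semi_inner_product ip.
Hypothesis cpl : geometrically_complete ip.
Variable S : H -> Prop.
Hypothesis S_lin : forall a f g, S f -> S g -> S (a *: f + g).
Hypothesis S_dense : forall f eps, 0 < eps ->
  exists2 s, S s & ip (f - s) (f - s) <= eps.
Variable A : H -> H.
Hypothesis A_lin : linear_up_to_null ip A.
Hypothesis A_sym : forall f g, ip f (A g) = ip g (A f).
Hypothesis A_ge0 : forall f, 0 <= ip f (A f).
Hypothesis A_le2 : forall f, ip f (A f) <= 2 * ip f f.

Let hq := quadratic_form_semi_inner_product hip A_sym A_ge0.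

Lemma S_dense_seq f : exists u : nat -> H, (forall n, S (u n)) /\
  ip (f - u n) (f - u n) @[n --> \oo] --> (0 : R).
Proof.
have /choice[u uP] : forall n : nat, exists s, S s /\
    ip (f - s) (f - s) <= 2^-1 ^+ n.
  by move=> n; have [|s] := @S_dense f (2^-1 ^+ n);
    [rewrite exprn_gt0|exists s].
exists u; split=> [n|]; first by have [] := uP n.
apply: (@squeeze_cvgr _ _ _ _ (fun=> 0) (fun n => 2^-1 ^+ n)).
- by apply: nearW => n; rewrite (ip_ge0 hip); have [] := uP n.
- exact: cvg_cst.
- by apply: cvg_expr; rewrite ger0_norm ?invr_ge0// invf_lt1// ltr1n.
Qed.

(** Systems are taken in the dense subspace [S], later the simple functions, because these are step
    functions on a finite partition. *)
Definition S_system k eps (f : 'I_k -> H) :=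
  near_kernel_system ip A eps f /\ forall i, S (f i).

Lemma S_sum (I : finType) (c : I -> R) (f : I -> H) : S 0 ->
  (forall i, S (f i)) -> S (\sum_i c i *: f i).
Proof. by move=> S0 Sf; elim/big_rec : _ => // i x _; exact: S_lin. Qed.

Lemma S_0 : S 0.
Proof.
have [s Ss _] := @S_dense 0 1 ltr01.
by have := S_lin (-1) Ss Ss; rewrite scaleN1r addrC subrr.
Qed.

(** Approximants of [w] in [S], projected off the [v i], stay in [S] and are exactly orthogonal to
    the system; the strict inequality survives the approximation. *)
Lemma S_system_extend k eps (v : 'I_k -> H) (w : H) : S_system eps v ->
  (forall i, ip w (v i) = 0) -> ip w (A w) < eps * ip w w ->
  exists v', @S_system k.+1 eps v'.
Proof.
move=> [[ov qv] Sv] wv qw.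
have [u [Su uw]] := S_dense_seq w.
pose r n := u n - \sum_i ip (u n) (v i) *: v i.
have Sr n : S (r n).
  rewrite /r addrC -scaleN1r; apply: S_lin => //; apply: S_sum => //; exact: S_0.
have rv n j : ip (r n) (v j) = 0.
  rewrite /r (ipBl hip) (ip_suml hip) (bigD1 j)//= (ipZl hip) ov eqxx mulr1.
  rewrite big1 ?addr0 ?subrr// => i ij.
  by rewrite (ipZl hip) ov (negbTE ij) mulr0.
have rw : ip (w - r n) (w - r n) @[n --> \oo] --> (0 : R).
  apply: (@squeeze_cvgr _ _ _ _ (fun=> 0)
    (fun n => (2 + 2 * k%:R) * ip (w - u n) (w - u n))).
  - apply: nearW => n; rewrite (ip_ge0 hip)/=.
    have -> : w - r n = (w - u n) + \sum_i ip (u n) (v i) *: v i.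
      by rewrite /r opprB addrCA addrC.
    rewrite (le_trans (ipD_le hip _ _))// [leRHS]mulrDl lerD2l.
    rewrite -[leRHS]mulrA ler_pM2l// (pythagoras hip)// mulr_natl -[k in leRHS]card_ord -sumr_const.
    apply: ler_sum => i _; rewrite -expr2.
    have -> : ip (u n) (v i) = - ip (w - u n) (v i).
      by rewrite (ipBl hip) wv sub0r opprK.
    rewrite sqrrN (le_trans (cauchy_schwarz hip _ _))//.
    by rewrite ov eqxx mulr1.
  - exact: cvg_cst.
  - by rewrite -[X in _ --> X](mulr0 (2 + 2 * k%:R)); exact: cvgMr.
have lim1 := cvg_ip_sqr hip rw.
have lim2 : ip (r n) (A (r n)) @[n --> \oo] --> ip w (A w).
  apply: (cvg_ip_sqr hq); apply: (@squeeze_cvgr _ _ _ _ (fun=> 0)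
    (fun n => 2 * ip (w - r n) (w - r n))).
  - by apply: nearW => n; rewrite A_ge0 A_le2.
  - exact: cvg_cst.
  - by rewrite -[X in _ --> X](mulr0 2); exact: cvgMr.
have [n qn] : exists n, ip (r n) (A (r n)) < eps * ip (r n) (r n).
  apply: contrapT => /forallNP h; move: qw; apply/negP; rewrite -leNgt.
  apply: (@ler_cvg_to _ _ _ _ (fun n => eps * ip (r n) (r n))
    (fun n => ip (r n) (A (r n))) _ _ _ lim2).
    by apply: cvgMr; exact: lim1.
  by apply: nearW => n; rewrite leNgt; apply/negP; exact: h.
pose s := ip (r n) (r n).
have s0 : 0 < s.
  rewrite lt_def (ip_ge0 hip) andbT; apply: contraTneq qn => e.
  by rewrite -/s e mulr0 -leNgt.
have ss : (Num.sqrt s)^-1 * (Num.sqrt s)^-1 = s^-1.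
  by rewrite -expr2 exprVn (sqr_sqrtr (ltW s0)).
pose x := (Num.sqrt s)^-1 *: r n.
have x1 : ip x x = 1.
  by rewrite (ipZl hip) (ipZr hip) mulrA ss mulVf// gt_eqF.
have xv j : ip x (v j) = 0 by rewrite (ipZl hip) rv mulr0.
exists (fun i => if unlift ord_max i is Some j then v j else x).
split; first split => [i j|i].
- case: unliftP => [i'|] ->; case: unliftP => [j'|] ->.
  + by rewrite ov (inj_eq lift_inj).
  + by rewrite (ipC hip) xv eq_sym (negbTE (neq_lift _ _)).
  + by rewrite xv (negbTE (neq_lift _ _)).
  + by rewrite x1 eqxx.
- case: unliftP => [i'|] _; first exact: qv.
  rewrite /x (ipZl hip) (ip_opZ A_lin) mulrA ss ler_pdivrMl// mulrC; exact: ltW.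
- move=> i; case: unliftP => [i'|] _; first exact: Sv.
  by rewrite -[x]addr0; apply: S_lin => //; exact: S_0.
Qed.

Lemma shifted_op_lin s : linear_up_to_null ip (fun f => A f - s *: f).
Proof.
by move=> h a f g; rewrite !(ipBr hip) A_lin !(ipZr hip) (ipDr hip) (ipZr hip); ring.
Qed.

Lemma shifted_op_le s f :
  ip (A f - s *: f) (A f - s *: f) <= (8 + 2 * s ^+ 2) * ip f f.
Proof.
rewrite (le_trans (ipD_le hip _ _))// (ipNl hip) (ipNr hip) opprK.
rewrite (ipZl hip) (ipZr hip).
have := norm_op_le hip A_sym A_ge0 A_le2 f; have := A_le2 f.
set x := ip f f; set y := ip _ _; set z := ip _ _ => *.
have -> : (8 + 2 * s ^+ 2) * x = 8 * x + 2 * (s * (s * x)) by ring.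
by rewrite lerD2r; lra.
Qed.

(* For a maximal S_system [v], the form of [A] is bounded below by [eps] on
   the orthogonal complement of [v]; adding a multiple of the projection on
   the span of [v] makes it coercive. *)
Lemma no_S_system_fredholm k eps s : 0 < eps -> s < eps / 2 ->
  ~ (exists v, @S_system k eps v) -> fredholm_op ip (fun f => A f - s *: f).
Proof.
move=> eps0 seps nk.
(* The empty system exists, so if every size could be increased there would be a system of size
   [k]. *)
have [j [v Sv] nj] : exists2 j, exists v, @S_system j eps v &
    ~ exists v, @S_system j.+1 eps v.
  apply: contrapT => nj; apply: nk; elim: k => [|k IH].
    by exists (fun=> 0); split; [split|]; case.
  apply: contrapT => nk; apply: nj; by exists k.
have gap w : (forall i, ip w (v i) = 0) -> eps * ip w w <= ip w (A w).
  move=> wv; rewrite leNgt; apply/negP => qw; apply: nj.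
  exact: S_system_extend Sv wv qw.
have [[ov _] _] := Sv.
(* From [eps |w|^2 <= (w, A w) <= 2 (f, A f) + 4 b] and [|f|^2 = |w|^2 + b] follows [(f, A f) + (2 +
   eps / 2) b >= eps / 2 |f|^2]. *)
pose c := Num.sqrt (2 + eps / 2).
have c2 : c ^+ 2 = 2 + eps / 2 by rewrite sqr_sqrtr// addr_ge0// divr_ge0// ltW.
apply: (@coercive_finite_rank_fredholm _ _ _ hip cpl _ j (fun i => c *: v i)
  (eps / 2 - s) (8 + 2 * s ^+ 2)).
- exact: shifted_op_lin.
- by rewrite subr_gt0.
- by rewrite addr_ge0// mulr_ge0// sqr_ge0.
- exact: shifted_op_le.
move=> f; pose p := \sum_i ip f (v i) *: v i; pose w := f - p.
pose b := \sum_i ip f (v i) ^+ 2.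
have pp : ip p p = b.
  by rewrite (pythagoras hip)//; apply: eq_bigr => i _; rewrite expr2.
have wv i : ip w (v i) = 0.
  rewrite (ipBl hip) (ip_suml hip) (bigD1 i)//= (ipZl hip) ov eqxx mulr1.
  rewrite big1 ?addr0 ?subrr// => l li.
  by rewrite (ipZl hip) ov (negbTE li) mulr0.
have wp : ip w p = 0.
  by rewrite (ip_sumr hip) big1// => i _; rewrite (ipZr hip) wv mulr0.
have ff : ip f f = ip w w + b.
  have fE : f = w + p by rewrite subrK.
  have h x y : ip x y = 0 -> ip (x + y) (x + y) = ip x x + ip y y.
    by move=> xy; rewrite !(ipE hip) (ipC hip y x) xy; ring.
  by rewrite [in LHS]fE (h _ _ wp) pp.
have qw : ip w (A w) <= 2 * ip f (A f) + 4 * b.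
  have := ipD_le hq f (- p); rewrite /= -/w (ipNl hip) (ip_opN A_lin) opprK.
  by have := A_le2 p; rewrite pp; lra.
have -> : \sum_i ip f (c *: v i) ^+ 2 = (2 + eps / 2) * b.
  rewrite mulr_sumr; apply: eq_bigr => i _.
  by rewrite (ipZr hip) exprMn c2.
rewrite (ipBr hip) (ipZr hip) mulrBl.
by have := gap w wv; rewrite ff; lra.
Qed.

(** The form is coercive by itself, as [A] is nonnegative; consequently the essential spectrum of
    [P] is bounded below by -1. *)
Lemma negative_shift_fredholm s : s < 0 ->
  fredholm_op ip (fun f => A f - s *: f).
Proof.
move=> s0; apply: (@coercive_finite_rank_fredholm _ _ _ hip cpl _ 0
  (fun=> 0) (- s) (8 + 2 * s ^+ 2)).
- exact: shifted_op_lin.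
- by rewrite oppr_gt0.
- by rewrite addr_ge0// mulr_ge0// sqr_ge0.
- exact: shifted_op_le.
- move=> f; rewrite big_ord0 addr0 (ipBr hip) (ipZr hip) mulNr.
  by rewrite lerDr A_ge0.
Qed.

End SpectralGap.

(** * The space of square integrable functions *)

Lemma geometric_sum_le (R : realFieldType) (q : R) (n k : nat) : 0 <= q < 1 ->
  \sum_(j < k) q ^+ (n + j) <= q ^+ n / (1 - q).
Proof.
move=> /andP[q0 q1]; have q10 : 0 < 1 - q by rewrite subr_gt0.
elim: k n => [|k IH] n; first by rewrite big_ord0 divr_ge0 ?exprn_ge0// ltW.
rewrite big_ord_recl addn0.
under eq_bigr do rewrite lift0 addnS -addSn.
rewrite (le_trans (lerD (lexx _) (IH _)))// exprS.
rewrite le_eqVlt; apply/orP; left; apply/eqP.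
by field; rewrite gt_eqF.
Qed.

(** Cauchy-Schwarz with weights [q ^+ j] turns weighted square summability into a geometric Cauchy
    estimate; the explicit rate is what gets integrated in the completeness of L2. *)
Lemma weighted_square_summable_cvg (R : realType) (a : R^nat) (q S : R) :
  0 < q < 1 ->
  (forall k, \sum_(j < k) q ^- j * (a j.+1 - a j) ^+ 2 <= S) ->
  exists2 l, a n @[n --> \oo] --> l &
    forall n, (a n - l) ^+ 2 <= q ^+ n / (1 - q) * S.
Proof.
move=> /andP[q0 q1] aS; have q10 : 0 < 1 - q by rewrite subr_gt0.
have tel n k : a (n + k)%N - a n = \sum_(j < k) (a (n + j).+1 - a (n + j)%N).
  elim: k => [|k IH]; first by rewrite addn0 subrr big_ord0.
  by rewrite big_ord_recr/= -IH addnS addrC addrA subrK.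
have diff n k : (a (n + k)%N - a n) ^+ 2 <= q ^+ n / (1 - q) * S.
  pose d j := a (n + j).+1 - a (n + j)%N.
  apply: (@le_trans _ _ ((\sum_(j < k) q ^+ (n + j)) *
      \sum_(j < k) q ^- (n + j) * d j ^+ 2)).
    rewrite tel -/d; apply: sqr_le_of_quadratic_ge0 => t.
    rewrite -[2 * _ * t]mulrA mulr_suml mulr_suml mulr_sumr -!big_split/=.
    apply: sumr_ge0 => j _.
    rewrite (_ : _ + _ = q ^- (n + j) * (q ^+ (n + j) * t + d j) ^+ 2).
      by rewrite mulr_ge0 ?sqr_ge0// invr_ge0 exprn_ge0// ltW.
    by rewrite /d; field; rewrite expf_neq0// gt_eqF.
  have ge0 j : 0 <= q ^- j * (a j.+1 - a j) ^+ 2.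
    by rewrite mulr_ge0 ?sqr_ge0// invr_ge0 exprn_ge0// ltW.
  apply: ler_pM.
  - by apply: sumr_ge0 => j _; rewrite exprn_ge0// ltW.
  - by apply: sumr_ge0.
  - by apply: geometric_sum_le; rewrite ltW.
  - apply: le_trans (aS (n + k)%N).
    by rewrite big_split_ord/= ler_wpDl// sumr_ge0.
have S0 : 0 <= S by have := aS 0%N; rewrite big_ord0.
pose B := (1 - q)^-1 * S.
have B0 : 0 <= B by rewrite mulr_ge0// invr_ge0 ltW.
have sq1 : `|Num.sqrt q| < 1.
  by rewrite ger0_norm ?sqrtr_ge0// -(sqrtr1 R) ltr_sqrt.
have cvg_tel : cvgn (series (fun n => a n.+1 - a n)).
  apply: normed_cvg; apply: (@series_le_cvg _ _
    (geometric (Num.sqrt B) (Num.sqrt q))) => [n|n|n|] /=.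
  - exact: normr_ge0.
  - by rewrite mulr_ge0 ?exprn_ge0 ?sqrtr_ge0.
  - have p0 : 0 <= Num.sqrt B * Num.sqrt q ^+ n.
      by rewrite mulr_ge0 ?exprn_ge0 ?sqrtr_ge0.
    rewrite -ler_sqr ?nnegrE// real_normK ?num_real// exprMn exprAC.
    rewrite (sqr_sqrtr B0) (sqr_sqrtr (ltW q0)).
    by have := diff n 1%N; rewrite addn1; congr (_ <= _); rewrite /B; ring.
  - by have := @is_cvg_geometric_series _ (Num.sqrt B) _ sq1.
have [l al] : exists l : R, a n @[n --> \oo] --> l.
  exists (a 0%N + limn (series (fun n => a n.+1 - a n))).
  have {1}-> : a = (fun n => a 0%N + series (fun n => a n.+1 - a n) n).
    apply/funext => n; rewrite /series/= big_mkord.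
    by have := tel 0%N n; rewrite add0n => <-; rewrite addrC subrK.
  by apply: cvgD; [exact: cvg_cst|exact: cvg_tel].
exists l => // n.
have lim : (a (n + k)%N - a n) ^+ 2 @[k --> \oo] --> (l - a n) ^+ 2.
  rewrite expr2; under eq_fun do rewrite expr2.
  have h : a (n + k)%N - a n @[k --> \oo] --> l - a n.
    apply: cvgB; last exact: cvg_cst.
    by under eq_fun do rewrite addnC; have := al; rewrite -(cvg_shiftn n).
  exact: cvgM.
rewrite -sqrrN opprB; apply: (ler_cvg_to lim (cvg_cst _)).
by apply: nearW => k; exact: diff.
Qed.

Section L2Space.
Context {d : measure_display} {T : measurableType d} {R : realType}.
Variable mu : probability T R.

Notation H := (LfunType mu (lee1n 2)).

Definition toL2 (f : T -> R) (hf : L2 mu f) : H := Lfun_Sub (lee1n 2) hf.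

Lemma L2P (f : H) : L2 mu f. Proof. exact: LfunP. Qed.

Lemma L2_measurable (f : T -> R) : L2 mu f -> measurable_fun setT f.
Proof. by rewrite /L2 inE => /andP[/[!inE]]. Qed.

Lemma L2_sqr_integrable (f : T -> R) : L2 mu f <->
  measurable_fun setT f /\ mu.-integrable setT (fun x => (f x ^+ 2)%:E).
Proof.
split=> [hf|[mf intf]].
  by split; [exact: L2_measurable|exact: Lfun2_integrable_sqr].
rewrite /L2 inE; apply/andP; split; rewrite inE//=.
rewrite /finite_norm unlock /Lnorm poweR_lty//.
case/integrableP : intf => _; apply: le_lt_trans.
rewrite le_eqVlt; apply/orP; left; apply/eqP; apply: eq_integral => x _.
by rewrite /= powR_mulrn// real_normK ?num_real// ger0_norm// sqr_ge0.
Qed.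

Lemma L2_mul_integrable (f g : T -> R) : L2 mu f -> L2 mu g ->
  mu.-integrable setT (EFin \o (f \* g)).
Proof. by move=> hf hg; apply/Lfun1_integrable; exact: Lfun2_mul_Lfun1. Qed.

Lemma ip_semi_inner_product : semi_inner_product (fun f g : H => ip mu f g).
Proof.
split.
- by move=> f g; rewrite /ip; under eq_integral do rewrite mulrC.
- move=> a f g h; rewrite -[ip mu _ _]/(Rintegral _ _ _).
  transitivity (Rintegral mu setT (fun x => a * (f x * h x) + g x * h x)).
    by apply: eq_Rintegral => x _; rewrite mulrA -mulrDl.
  have fh := L2_mul_integrable (L2P f) (L2P h).
  have gh := L2_mul_integrable (L2P g) (L2P h).
  rewrite RintegralD ?RintegralZl//.
  by have := integrableZl measurableT a fh.
- move=> f; apply: Rintegral_ge0 => x _; rewrite -expr2; exact: sqr_ge0.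
Qed.

Lemma ip_sqrE (f : T -> R) : L2 mu f ->
  (ip mu f f)%:E = (\int[mu]_x (f x ^+ 2)%:E)%E.
Proof.
move=> hf; rewrite /ip fineK; first by under eq_integral do rewrite -expr2.
by apply: integrable_fin_num => //; exact: L2_mul_integrable.
Qed.

(** The weighted sum [G] of squared increments has finite integral, and where it is finite the
    sequence converges at a rate proportional to [G]; integrating the rate gives convergence in
    norm. *)
Lemma ip_geometrically_complete :
  geometrically_complete (fun f g : H => ip mu f g).
Proof.
move=> u C r /andP[r0 r1] uC.
(* Strictly between [r] and 1, so that the weights [q ^- n] leave the summable ratio [r / q]. *)
pose q := (1 + r) / 2.
have q0 : 0 < q by rewrite /q; lra.
have q1 : q < 1 by rewrite /q; lra.
have rq : 0 <= r / q < 1.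
  apply/andP; split; first exact: divr_ge0 r0 (ltW q0).
  by rewrite ltr_pdivrMr// mul1r /q; lra.
pose g (n : nat) (x : T) : R := q ^- n * (u n.+1 x - u n x) ^+ 2.
have qi n : 0 <= q ^- n by rewrite invr_ge0 exprn_ge0 ?ltW.
have g0 n x : 0 <= g n x by rewrite mulr_ge0// sqr_ge0.
pose G x : \bar R := (\sum_(0 <= n <oo) (g n x)%:E)%E.
have mu_ n : measurable_fun setT (u n) := L2_measurable (L2P (u n)).
have mg n : measurable_fun setT (fun x => (g n x)%:E).
  apply/measurable_EFinP; apply: measurable_funM => //.
  by apply: measurable_funX; exact: measurable_funB.
have G0 x : (0 <= G x)%E by apply: nneseries_ge0 => n _ _; rewrite lee_fin.
have mG : measurable_fun setT G.
  have := @ge0_emeasurable_sum _ _ R setT (fun n x => (g n x)%:E) xpredT.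
  by apply => // *; rewrite lee_fin.
have intg n : (\int[mu]_x (g n x)%:E <= (C * (r / q) ^+ n)%:E)%E.
  under eq_integral do rewrite EFinM.
  rewrite ge0_integralZl_EFin//; last 2 first.
    by move=> x _; rewrite lee_fin sqr_ge0.
    by apply/measurable_EFinP; apply: measurable_funX; exact: measurable_funB.
  rewrite -[X in (_ * X)%E](ip_sqrE (L2P (u n.+1 - u n))) -EFinM lee_fin.
  rewrite (_ : C * _ = q ^- n * (C * r ^+ n)); last by rewrite expr_div_n; ring.
  by apply: (ler_wpM2l (qi n)); exact: (uC n).
have intG : (\int[mu]_x G x <= (C / (1 - r / q))%:E)%E.
  rewrite integral_nneseries//; last by move=> n x _; rewrite lee_fin.
  apply: lime_le.
    by apply: is_cvg_nneseries => n _ _; apply: integral_ge0 => x _; rewrite lee_fin.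
  apply: nearW => n; rewrite (le_trans (lee_sum _ (fun i _ => intg i)))//.
  rewrite sumEFin lee_fin -mulr_sumr big_mkord ler_wpM2l//.
    have := uC 0%N; rewrite mulr1; apply: le_trans.
    exact: ip_ge0 ip_semi_inner_product _.
  by have := geometric_sum_le 0 n rq; rewrite expr0 mul1r; apply.
have lim x : (G x < +oo)%E -> exists2 l : R, u n x @[n --> \oo] --> l &
    forall n, (((u n x - l) ^+ 2)%:E <= (q ^+ n / (1 - q))%:E * G x)%E.
  move=> Gx; have Gfin : G x \is a fin_num by rewrite ge0_fin_numE.
  have [||l ul h] := @weighted_square_summable_cvg _ (u ^~ x) q (fine (G x)).
  - by rewrite q0 q1.
  - move=> k; rewrite -lee_fin fineK//.
    have := @nneseries_lim_ge R (fun n => (g n x)%:E) xpredT 0 k.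
    by rewrite sumEFin big_mkord; apply => *; rewrite lee_fin.
  - exists l => // n; rewrite -[G x]fineK// -EFinM lee_fin; exact: h.
(* Where [G] is infinite any value serves, as the bound [v_le] is infinite too. Subtracting [u 0]
   makes the square integrability of [v] the case [n = 0] of [int_le]. *)
pose v x := if (G x < +oo)%E then limn (u ^~ x) - u 0%N x else 0.
have mD : measurable_fun setT (fun x => (G x < +oo)%E).
  apply: (measurable_fun_bool true).
  by rewrite setTI; have := emeasurable_fun_infty_o measurableT mG +oo%E; rewrite setTI.
have mv : measurable_fun setT v.
  apply: (@measurable_fun_cvg _ _ _ setT
    (fun n x => if (G x < +oo)%E then u n x - u 0%N x else 0)).
    by move=> n; apply: measurable_fun_ifT => //; exact: measurable_funB.
  move=> x _; rewrite /v; case: ifPn => [/lim[l ul _]|_]; last exact: cvg_cst.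
  rewrite (cvg_lim _ ul)//; apply: cvgB => //; exact: cvg_cst.
have cq n : 0 < q ^+ n / (1 - q) by rewrite divr_gt0 ?exprn_gt0// subr_gt0.
have v_le n x : (((u n x - (v x + u 0%N x)) ^+ 2)%:E <=
    (q ^+ n / (1 - q))%:E * G x)%E.
  rewrite /v; case: ifPn => [/lim[l ul h]|].
    by rewrite (cvg_lim _ ul)// subrK.
  rewrite -leNgt leye_eq => /eqP ->; rewrite gt0_muley ?leey// lte_fin; exact: cq.
have int_le n : (\int[mu]_x ((u n x - (v x + u 0%N x)) ^+ 2)%:E <=
    (q ^+ n / (1 - q) * (C / (1 - r / q)))%:E)%E.
  have m1 : measurable_fun setT (fun x => u n x - (v x + u 0%N x)).
    by apply: measurable_funB => //; exact: measurable_funD.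
  rewrite EFinM; apply: (@le_trans _ _ (\int[mu]_x ((q ^+ n / (1 - q))%:E * G x))%E).
    apply: ge0_le_integral => //.
    - by move=> x _; rewrite lee_fin sqr_ge0.
    - by apply/measurable_EFinP; exact: measurable_funX.
    - by apply: measurable_funeM.
  rewrite ge0_integralZl_EFin//; last exact: ltW.
  by apply: lee_wpmul2l => //; rewrite lee_fin; exact: ltW.
have hv : L2 mu v.
  apply/L2_sqr_integrable; split => //; apply/integrableP; split.
    by apply/measurable_EFinP; exact: measurable_funX.
  apply: le_lt_trans (ltry (q ^+ 0 / (1 - q) * (C / (1 - r / q)))).
  apply: le_trans (int_le 0%N).
  rewrite le_eqVlt; apply/orP; left; apply/eqP; apply: eq_integral => x _.
  rewrite gee0_abs ?lee_fin ?sqr_ge0//; congr (_%:E); ring.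
exists (toL2 hv + u 0%N).
apply: (@squeeze_cvgr _ _ _ _ (fun=> 0)
  (fun n => q ^+ n * ((1 - q)^-1 * (C / (1 - r / q))))).
- apply: nearW => n; rewrite (ip_ge0 ip_semi_inner_product)/= -lee_fin.
  rewrite (ip_sqrE (L2P (u n - (toL2 hv + u 0%N)))) mulrA; exact: int_le.
- exact: cvg_cst.
- rewrite -[X in _ --> X](mul0r ((1 - q)^-1 * (C / (1 - r / q)))).
  by apply: cvgMl; apply: cvg_expr; rewrite ger0_norm ?ltW.
Qed.

Lemma L2_dominated (f g : T -> R) : measurable_fun setT f -> L2 mu g ->
  (forall x, `|f x| <= `|g x|) -> L2 mu f.
Proof.
move=> mf hg fg; apply/L2_sqr_integrable; split => //.
have /L2_sqr_integrable[_] := hg; apply: le_integrable => //.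
  by apply/measurable_EFinP; exact: measurable_funX.
move=> x _; rewrite !gee0_abs ?lee_fin ?sqr_ge0//.
by rewrite -(real_normK (num_real (f x))) -(real_normK (num_real (g x)))
  ler_sqr ?nnegrE.
Qed.

Lemma bounded_L2 (f : T -> R) (M : R) : measurable_fun setT f ->
  (forall x, `|f x| <= M) -> L2 mu f.
Proof.
move=> mf fM; apply: (@L2_dominated f (cst M)) => //; first exact: Lfun_cst.
by move=> x; rewrite (le_trans (fM x))// ler_norm.
Qed.

Import HBSimple HBNNSimple.

Lemma simple_dense_nonneg (f : H) (eps : R) : (forall x, 0 <= f x) -> 0 < eps ->
  exists2 s : H, finite_set (range s) & ip mu (f - s) (f - s) <= eps.
Proof.
move=> f0 eps0; have mf := L2_measurable (L2P f).
have mfE : measurable_fun setT (EFin \o f) by exact/measurable_EFinP.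
pose s_ := nnsfun_approx measurableT mfE.
have s_le n x : s_ n x <= f x.
  rewrite -lee_fin nnsfun_approxE; apply: le_approx => // y _.
  by rewrite lee_fin.
have ms n : measurable_fun setT (s_ n) by [].
have L2s n : L2 mu (s_ n).
  apply: (L2_dominated (ms n) (L2P f)) => x.
  by rewrite !ger0_norm.
have mfs n : measurable_fun setT (fun x => f x - s_ n x) by exact: measurable_funB.
have /L2_sqr_integrable[_ if2] := L2P f.
have [] := @dominated_convergence _ _ _ mu setT measurableT
  (fun n x => ((f x - s_ n x) ^+ 2)%:E) (cst 0%E) (fun x => (f x ^+ 2)%:E).
- by move=> n; apply/measurable_EFinP; exact: measurable_funX.
- exact: measurable_cst.
- apply: aeW => x _.
  have /fine_cvgP[_] : (s_ n x)%:E @[n --> \oo] --> (f x)%:E.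
    by apply: (cvg_nnsfun_approx measurableT mfE) => // y _; rewrite lee_fin.
  move=> sf; apply/cvg_EFin; first exact: nearW.
  have h : f x - s_ n x @[n --> \oo] --> f x - f x.
    by apply: cvgB => //; exact: cvg_cst.
  have := cvgM h h; rewrite subrr mulr0 => /(_ _).
  by apply: cvg_trans; apply: near_eq_cvg; apply: nearW => n /=; exact: expr2.
- exact: if2.
- apply: aeW => x n _; rewrite gee0_abs ?lee_fin ?sqr_ge0//.
  by rewrite ler_sqr ?nnegrE// ?subr_ge0 ?gerBl.
move=> _ _; rewrite integral0 => /fine_cvgP[_ /cvgr_le/(_ _ eps0)].
case=> N _ /(_ N (leqnn N)) /= hN.
exists (toL2 (L2s N)); first exact: fimfunP.
by rewrite -lee_fin (ip_sqrE (L2P (f - toL2 (L2s N)))) -[leLHS]fineK//;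
  have := ip_sqrE (L2P (f - toL2 (L2s N))) => <-.
Qed.

Lemma simple_dense (f : H) (eps : R) : 0 < eps ->
  exists2 s : H, finite_set (range s) & ip mu (f - s) (f - s) <= eps.
Proof.
move=> eps0; have mf := L2_measurable (L2P f).
have hp : L2 mu (f^\+)%R.
  apply: (L2_dominated _ (L2P f)); first exact: measurable_funrpos.
  move=> x; rewrite /funrpos; case: (leP (f x) 0) => _//.
  by rewrite normr0 normr_ge0.
have hn : L2 mu (f^\-)%R.
  apply: (L2_dominated _ (L2P f)); first exact: measurable_funrneg.
  move=> x; rewrite /funrneg -[leRHS]normrN; case: (leP (- f x) 0) => _//.
  by rewrite normr0 normr_ge0.
have eps4 : 0 < eps / 4 by rewrite divr_gt0.
have [sp fsp hsp] := @simple_dense_nonneg (toL2 hp) _ (funrpos_ge0 f) eps4.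
have [sn fsn hsn] := @simple_dense_nonneg (toL2 hn) _ (funrneg_ge0 f) eps4.
exists (sp - sn).
  apply: sub_finite_set (finite_image2 (fun a b => a - b) fsp fsn).
  by move=> _ [x _ <-]; exists (sp x) => //; exists (sn x).
have -> : f - (sp - sn) = (toL2 hp - sp) + - (toL2 hn - sn).
  apply/LfuneqP => x.
  rewrite -[LHS]/(f x - (sp x - sn x)).
  rewrite -[RHS]/((f^\+)%R x - sp x - ((f^\-)%R x - sn x)).
  have <- : (f^\+)%R x - (f^\-)%R x = f x by rewrite -[in RHS](funrposBneg f).
  by ring.
rewrite (le_trans (ipD_le ip_semi_inner_product _ _))//.
rewrite (ipNl ip_semi_inner_product) (ipNr ip_semi_inner_product) opprK.
by rewrite /= in hsp hsn *; lra.
Qed.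

End L2Space.

(** * Markov operators *)

Section Markov.
Context {d : measure_display} {T : measurableType d} {R : realType}.
Variable mu : probability T R.
Notation H := (LfunType mu (lee1n 2)).
Notation ipH := (fun f g : H => ip mu f g).

Let hip := ip_semi_inner_product mu.

Lemma ip_ae_equal (h f g : T -> R) : L2 mu h -> L2 mu f -> L2 mu g ->
  ae_equal mu f g -> ip mu h f = ip mu h g.
Proof.
move=> hh hf hg fg; rewrite /ip; congr fine.
have [mh mf mg] := And3 (L2_measurable hh) (L2_measurable hf) (L2_measurable hg).
apply: ae_eq_integral => //.
- by apply/measurable_EFinP; exact: measurable_funM.
- by apply/measurable_EFinP; exact: measurable_funM.
- by apply: filterS fg => x -> _.
Qed.

Lemma ae_equal_of_null (f g : H) : ip mu (f - g) (f - g) = 0 -> ae_equal mu f g.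
Proof.
move=> fg0; have hfg := L2P (f - g).
have := ip_sqrE hfg; rewrite fg0 => /esym i0.
have m2 : measurable_fun setT (fun x => (((f - g) x) ^+ 2)%:E).
  by apply/measurable_EFinP; apply: measurable_funX; exact: L2_measurable hfg.
have [+ _] := @ae_eq_integral_abs _ _ _ mu setT measurableT _ m2.
have -> : (\int[mu]_x `|(((f - g) x) ^+ 2)%:E| = 0)%E.
  rewrite -[RHS]i0; apply: eq_integral => x _.
  by rewrite gee0_abs// lee_fin sqr_ge0.
move=> /(_ erefl); apply: filterS => x /(_ I) /= [].
by move=> /eqP; rewrite sqrf_eq0 subr_eq0 => /eqP.
Qed.

Lemma L2_indic (A : set T) : measurable A -> L2 mu (\1_A : T -> R).
Proof.
move=> mA; apply: (@bounded_L2 _ _ _ _ _ 1); first exact: measurable_indic.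
by move=> x; rewrite indicE; case: (_ \in _); rewrite ?normr1 ?normr0.
Qed.

Definition chi (A : set T) (mA : measurable A) : H := toL2 (L2_indic mA).
Definition one : H := toL2 (Lfun_cst mu 1 2).

Lemma ip_chi_chi A B (mA : measurable A) (mB : measurable B) :
  ip mu (chi mA) (chi mB) = fine (mu (A `&` B)).
Proof.
rewrite /ip; congr fine.
under eq_integral do rewrite /= -[X in X%:E]/((\1_A \* \1_B) _) -indicI.
by rewrite integral_indic ?setIT//; exact: measurableI.
Qed.

Lemma ip_chi_one A (mA : measurable A) : ip mu (chi mA) one = fine (mu A).
Proof.
rewrite /ip; under eq_integral do rewrite /= mulr1.
by rewrite integral_indic ?setIT.
Qed.

Lemma sum_LfunE (I : finType) (Q : pred I) (f : I -> H) x :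
  (\sum_(i | Q i) f i) x = \sum_(i | Q i) f i x.
Proof.
elim/big_rec2 : _ => // i y1 y2 _ <-.
by [].
Qed.

Section Operator.
Variable P : (T -> R) -> (T -> R).
Hypothesis markovP : markov_operator mu P.
Hypothesis revP : reversible mu P.

Lemma P_L2 (f : T -> R) : L2 mu f -> L2 mu (P f).
Proof. by have [[h _ _] _ _] := markovP; exact: h. Qed.

Definition PH (f : H) : H := toL2 (P_L2 (L2P f)).

Lemma PH_lin : linear_up_to_null ipH PH.
Proof.
have [[_ _ h] _ _] := markovP => k a f g.
have := h a f g (L2P f) (L2P g) => e.
rewrite -(ipZr hip) -(ipDr hip).
apply: ip_ae_equal => //; exact: L2P.
Qed.

Lemma PH_sym (f g : H) : ip mu f (PH g) = ip mu g (PH f).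
Proof. exact: revP (L2P g) (L2P f). Qed.

Lemma PH_one (h : H) : ip mu h (PH one) = ip mu h one.
Proof.
have [_ e _] := markovP; apply: ip_ae_equal => //; exact: L2P.
Qed.

Lemma ip_PH_ge0 (f g : H) : (forall x, 0 <= f x) -> (forall x, 0 <= g x) ->
  0 <= ip mu f (PH g).
Proof.
move=> f0 g0; rewrite /ip fine_ge0//.
have [_ _ h] := markovP; have Pg := h g (L2P g) (aeW _ g0).
have [mf mPg] := (L2_measurable (L2P f), L2_measurable (L2P (PH g))).
(* [P g] is nonnegative only almost everywhere, hence the truncation at 0. *)
rewrite (@ae_eq_integral _ _ _ mu setT (fun x => (f x * Num.max (PH g x) 0)%:E)
  (fun x => (f x * PH g x)%:E)) //.
- by apply: integral_ge0 => x _; rewrite lee_fin mulr_ge0// le_max lexx orbT.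
- by apply/measurable_EFinP; exact: measurable_funM.
- apply/measurable_EFinP; apply: measurable_funM => //.
  exact: measurable_maxr.
- by apply: filterS Pg => x Pgx _; rewrite max_l.
Qed.

Lemma chi_ge0 A (mA : measurable A) x : 0 <= chi mA x.
Proof. by rewrite /= indicE. Qed.

(* The blocks of the partition are the vertices of a finite weighted graph
   with edge weights [ip (chi (A v)) (P (chi (A w)))]. *)
Lemma simple_partition (K : nat) (f : 'I_K -> H) :
  (forall i, finite_set (range (f i))) ->
  exists (V : finType) (X : V -> 'rV[R]_K) (A : V -> set T)
    (mA : forall v, measurable (A v)),
    [/\ forall v w, v != w -> A v `&` A w = set0,
      \sum_v chi (mA v) = one &
      forall i, f i = \sum_v X v 0 i *: chi (mA v)].
Proof.
move=> finf; pose F t : 'rV[R]_K := \row_i f i t.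
have [s0 fs0] : exists s0 : seq R, forall i t, f i t \in s0.
  have /choice[s sE] : forall i, exists s : seq R, range (f i) = [set` s].
    by move=> i; exact/finite_seqP/finf.
  exists (flatten [seq s i | i <- enum 'I_K]) => i t.
  apply/flattenP; exists (s i); first by rewrite map_f// mem_enum.
  have : range (f i) (f i t) by exists t.
  by rewrite sE.
have /finite_seqP[s sE] : finite_set (range F).
  apply: (@sub_finite_set _ _ ((fun g : {ffun 'I_K -> seq_sub s0} =>
      \row_i ssval (g i)) @` setT)); last exact/finite_image/finite_finset.
  move=> _ [t _ <-]; exists [ffun i => SeqSub (fs0 i t)] => //.
  by apply/rowP => i; rewrite !mxE ffunE.
pose A (v : seq_sub s) := F @^-1` [set ssval v].
have mA v : measurable (A v).
  have -> : A v = \bigcap_(i in [set: 'I_K]) (f i @^-1` [set ssval v 0 i]).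
    apply/seteqP; split=> t; first by move=> <- i _; rewrite /= mxE.
    by move=> h; apply/rowP => i; rewrite mxE; exact: h.
  apply: fin_bigcap_measurable; first exact: finite_finset.
  move=> i _; rewrite -[X in measurable X]setTI.
  by apply: (L2_measurable (L2P (f i))).
have Fs t : F t \in s.
  have : range F (F t) by exists t.
  by rewrite sE.
have chiE v t : chi (mA v) t = (v == SeqSub (Fs t))%:R.
  rewrite /= indicE; congr (_%:R); congr nat_of_bool.
  apply/idP/eqP => [|->]; last by rewrite inE.
  by rewrite inE /A /= => Ft; apply/val_inj.
exists (seq_sub s : finType), (fun v => ssval v), A, mA; split.
- move=> v w vw; rewrite -subset0 => t [Av Aw]; move/eqP: vw; apply.
  by apply/val_inj; rewrite -[LHS]Av -[RHS]Aw.
- apply/LfuneqP => t; rewrite sum_LfunE (bigD1 (SeqSub (Fs t)))//= big1 => [|v vt].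
    by have := chiE (SeqSub (Fs t)) t; rewrite eqxx /= => ->; rewrite addr0.
  by have := chiE v t; rewrite (negbTE vt).
- move=> i; apply/LfuneqP => t; rewrite sum_LfunE (bigD1 (SeqSub (Fs t)))//= big1 => [|v vt].
    have := chiE (SeqSub (Fs t)) t; rewrite eqxx /= => e.
    by rewrite -[X in _ = X + _]/(_ * \1_(A _) t) e mulr1 addr0 mxE.
  have := chiE v t; rewrite (negbTE vt) /= => e.
  by rewrite -[LHS]/(_ * \1_(A _) t) e mulr0.
Qed.

End Operator.
End Markov.

(** * The quadratic form of a Markov operator on a finite partition *)

Section MarkovForm.
Context {d : measure_display} {T : measurableType d} {R : realType}.
Variables (mu : probability T R) (P : (T -> R) -> (T -> R)).
Hypothesis markovP : markov_operator mu P.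
Hypothesis revP : reversible mu P.
Notation H := (LfunType mu (lee1n 2)).
Notation ipH := (fun f g : H => ip mu f g).
Notation PH := (PH markovP).

Let hip := ip_semi_inner_product mu.
Let PHl := PH_lin markovP.

Definition simple_fun (f : H) : Prop := finite_set (range f).

Lemma simple_fun_lin (a : R) (f g : H) :
  simple_fun f -> simple_fun g -> simple_fun (a *: f + g).
Proof.
move=> ff fg; apply: sub_finite_set (finite_image2 (fun x y => a * x + y) ff fg).
by move=> _ [x _ <-]; exists (f x) => //; exists (g x).
Qed.

Section Partition.
Variables (V : finType) (A : V -> set T) (mA : forall v, measurable (A v)).
Hypothesis disjA : forall v w, v != w -> A v `&` A w = set0.
Hypothesis sumA : \sum_v chi mu (mA v) = one mu.

Let c v := chi mu (mA v).

Definition weight v w : R := ip mu (c v) (PH (c w)).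

Lemma weight_ge0 v w : 0 <= weight v w.
Proof. by apply: ip_PH_ge0 => x; exact: chi_ge0. Qed.

Lemma weight_sym v w : weight v w = weight w v.
Proof. exact: PH_sym revP _ _. Qed.

(** Row sums are measures because [P] fixes the constant 1, which is the sum of the block
    indicators. *)
Lemma mass_weight v : mass weight v = fine (mu (A v)).
Proof.
rewrite -(ip_chi_one mu (mA v)) -(PH_one markovP) -sumA.
by rewrite (ip_op_sum PHl).
Qed.

Lemma ip_step (a b : V -> R) :
  ip mu (\sum_v a v *: c v) (\sum_v b v *: c v) =
  \sum_v mass weight v * (a v * b v).
Proof.
rewrite (ip_suml hip); apply: eq_bigr => v _.
rewrite (ipZl hip) (ip_sumr hip) (bigD1 v)// (ipZr hip) ip_chi_chi setIid.
rewrite -mass_weight big1 => [|w /andP[_ wv]]; first by rewrite /= addr0; ring.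
by rewrite (ipZr hip) ip_chi_chi disjA 1?eq_sym// measure0 mulr0.
Qed.

Lemma ip_PH_step (a b : V -> R) :
  ip mu (\sum_v a v *: c v) (PH (\sum_v b v *: c v)) =
  \sum_v \sum_w weight v w * (a v * b w).
Proof.
rewrite (ip_suml hip); apply: eq_bigr => v _.
rewrite (ipZl hip) (ip_op_sum PHl) mulr_sumr; apply: eq_bigr => w _.
by rewrite (ip_opZ PHl) /weight; ring.
Qed.

Lemma mass_weightE (a : V -> R) : \sum_v mass weight v * a v =
  \sum_v \sum_w weight v w * ((a v + a w) / 2).
Proof.
transitivity (\sum_v \sum_w (weight v w * a v / 2) +
    \sum_v \sum_w (weight v w * a w / 2)).
  rewrite [X in _ + X]exchange_big/= -big_split/=; apply: eq_bigr => v _.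
  rewrite -big_split/= /mass mulr_suml; apply: eq_bigr => w _.
  by rewrite (weight_sym w v); field.
rewrite -big_split/=; apply: eq_bigr => v _; rewrite -big_split/=.
by apply: eq_bigr => w _; field.
Qed.

(** Symmetry of the weights merges the two square terms, so the edge energy is twice the form of
    [P + 1]. *)
Lemma energy_step (a : V -> R) :
  \sum_v \sum_w weight v w * (a v + a w) ^+ 2 =
  2 * (ip mu (\sum_v a v *: c v) (PH (\sum_v a v *: c v)) +
       ip mu (\sum_v a v *: c v) (\sum_v a v *: c v)).
Proof.
rewrite ip_PH_step ip_step mass_weightE -big_split/= mulr_sumr.
apply: eq_bigr => v _; rewrite -big_split/= mulr_sumr; apply: eq_bigr => w _.
by field.
Qed.

End Partition.

(** Apply [a b <= (a^2 + b^2) / 2] on each edge: the weights are nonnegative, and their row and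
    column sums are the masses. *)
Lemma ip_PH_simple_le (f g : H) : simple_fun f -> simple_fun g ->
  ip mu f (PH g) <= (ip mu f f + ip mu g g) / 2.
Proof.
move=> sf sg; pose u (i : 'I_2) := if i == 0 then f else g.
have [|V [X [A [mA [disj sum1 uE]]]]] := @simple_partition _ _ _ mu 2 u.
  by move=> i; rewrite /u; case: ifP.
have -> : f = \sum_v X v 0 0 *: chi mu (mA v) by have := uE 0.
have -> : g = \sum_v X v 0 1 *: chi mu (mA v) by have := uE 1.
have massl (a : V -> R) : \sum_v mass (weight mA) v * a v =
    \sum_v \sum_w weight mA v w * a v.
  by apply: eq_bigr => v _; rewrite mulr_suml.
have massr (a : V -> R) : \sum_v mass (weight mA) v * a v =
    \sum_v \sum_w weight mA v w * a w.
  rewrite massl exchange_big/=; apply: eq_bigr => v _; apply: eq_bigr => w _.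
  by rewrite (weight_sym mA).
rewrite ip_PH_step// !ip_step// [X in X + _]massl [X in _ + X]massr.
rewrite -big_split/= mulr_suml; apply: ler_sum => v _.
rewrite -big_split/= mulr_suml; apply: ler_sum => w _.
have := ler_wpM2l (weight_ge0 mA v w) (sqr_ge0 (X v 0 0 - X w 0 1)).
by rewrite mulr0; lra.
Qed.

(** Continuity of [P] is not yet available, so each density step approximates the argument to which
    [P] is not applied; reversibility first moves [g] there. *)
Lemma ip_PH_le (f g : H) : ip mu f (PH g) <= (ip mu f f + ip mu g g) / 2.
Proof.
have lin_dense (h : H) := @S_dense_seq _ _ ipH hip simple_fun
  (@simple_dense _ _ _ mu) h.
have half (h k : H) : simple_fun h ->
    ip mu h (PH k) <= (ip mu h h + ip mu k k) / 2.
  move=> sh; have [u [su uk]] := lin_dense k.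
  rewrite (PH_sym markovP revP).
  have l1 : ip mu (u n) (PH h) @[n --> \oo] --> ip mu k (PH h).
    have -> : (fun n => ip mu (u n) (PH h)) = (fun n => ip mu (PH h) (u n)).
      by apply/funext => n; rewrite (ipC hip).
    by rewrite (ipC hip k); apply: (cvg_ip hip).
  have l2 : (ip mu h h + ip mu (u n) (u n)) / 2 @[n --> \oo] -->
      (ip mu h h + ip mu k k) / 2.
    by apply: cvgMl; apply: cvgD; [exact: cvg_cst|exact: (cvg_ip_sqr hip)].
  apply: (ler_cvg_to l1 l2); apply: nearW => n.
  by rewrite (PH_sym markovP revP); exact: ip_PH_simple_le.
have [u [su uf]] := lin_dense f.
have l1 : ip mu (u n) (PH g) @[n --> \oo] --> ip mu f (PH g).
  have -> : (fun n => ip mu (u n) (PH g)) = (fun n => ip mu (PH g) (u n)).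
    by apply/funext => n; rewrite (ipC hip).
  by rewrite (ipC hip f); apply: (cvg_ip hip).
have l2 : (ip mu (u n) (u n) + ip mu g g) / 2 @[n --> \oo] -->
    (ip mu f f + ip mu g g) / 2.
  by apply: cvgMl; apply: cvgD; [exact: (cvg_ip_sqr hip)|exact: cvg_cst].
by apply: (ler_cvg_to l1 l2); apply: nearW => n; exact: half.
Qed.

Definition PH1 (f : H) : H := PH f + f.

Lemma ip_PH1 (f g : H) : ip mu f (PH1 g) = ip mu f (PH g) + ip mu f g.
Proof. exact: (ipDr hip). Qed.

Lemma PH1_lin : linear_up_to_null ipH PH1.
Proof.
move=> h a f g; rewrite !ip_PH1 PHl.
by rewrite (ipDr hip) (ipZr hip); ring.
Qed.

Lemma PH1_sym (f g : H) : ip mu f (PH1 g) = ip mu g (PH1 f).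
Proof. by rewrite !ip_PH1 (PH_sym markovP revP) (ipC hip f). Qed.

Lemma PH1_ge0 (f : H) : 0 <= ip mu f (PH1 f).
Proof.
rewrite ip_PH1; have := ip_PH_le (- f) f.
by rewrite (ipNl hip) (ipNl hip) (ipNr hip) opprK; lra.
Qed.

Lemma PH1_le2 (f : H) : ip mu f (PH1 f) <= 2 * ip mu f f.
Proof. by rewrite ip_PH1; have := ip_PH_le f f; lra. Qed.

End MarkovForm.

(** * Dual Cheeger constants, near-kernel systems and the essential spectrum *)

Lemma bigmin_le_mem (R : realType) (s : seq nat) (F : nat -> \bar R) i :
  i \in s -> (\big[Order.min/+oo]_(j <- s) F j <= F i)%E.
Proof.
elim: s => // j s IH; rewrite inE big_cons => /predU1P[<-|/IH h].
  by rewrite ge_min lexx.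
by rewrite ge_min h orbT.
Qed.

Lemma le_bigmin_nat (R : realType) (x : \bar R) m n (F : nat -> \bar R) :
  (forall i, (m <= i < n)%N -> (x <= F i)%E) ->
  (x <= \big[Order.min/+oo]_(m <= i < n) F i)%E.
Proof.
move=> h; rewrite big_nat; elim/big_ind : _ => //; first by rewrite leey.
by move=> a b xa xb; rewrite le_min xa.
Qed.

Section Assembly.
Context {d : measure_display} {T : measurableType d} {R : realType}.
Variables (mu : probability T R) (P : (T -> R) -> (T -> R)).
Hypothesis markovP : markov_operator mu P.
Hypothesis revP : reversible mu P.
Notation H := (LfunType mu (lee1n 2)).
Notation ipH := (fun f g : H => ip mu f g).
Notation PH := (PH markovP).
Notation PH1 := (PH1 markovP).

Let hip := ip_semi_inner_product mu.
Let PHl := PH_lin markovP.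

Section Cells.
Variables (V : finType) (A : V -> set T) (mA : forall v, measurable (A v)).
Hypothesis disjA : forall v w, v != w -> A v `&` A w = set0.
Hypothesis sumA : \sum_v chi mu (mA v) = one mu.

Definition cells (S : {set V}) : set T := \bigcup_(v in [set` S]) A v.

Lemma measurable_cells S : measurable (cells S).
Proof. by apply: fin_bigcup_measurable => //; exact: finite_finset. Qed.

Lemma chi_cells S : chi mu (measurable_cells S) =
  \sum_v (v \in S)%:R *: chi mu (mA v).
Proof.
apply/LfuneqP => t; rewrite sum_LfunE.
rewrite -[LHS]/(\1_(cells S) t) indicE.
have term v : ((v \in S)%:R *: chi mu (mA v)) t = (v \in S)%:R * (t \in A v)%:R.
  by rewrite -indicE.
under eq_bigr do rewrite term.
have [|tS] := boolP (t \in cells S).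
  rewrite inE => -[v vS Avt]; rewrite /= in vS.
  rewrite (bigD1 v)//= vS mem_set// mulr1 big1 ?addr0// => w wv.
  rewrite (_ : (t \in A w) = false) ?mulr0//.
  apply/negbTE/negP; rewrite inE => Awt.
  by have : (A w `&` A v) t by []; rewrite disjA.
rewrite big1// => v _; case: (boolP (v \in S)) => vS; last by rewrite mul0r.
rewrite (_ : (t \in A v) = false) ?mulr0//.
apply/negbTE; apply: contra tS; rewrite !inE => Avt; by exists v.
Qed.

Lemma cells_disjoint (S S' : {set V}) : [disjoint S & S']%B ->
  cells S `&` cells S' = set0.
Proof.
move=> SS'; rewrite -subset0 => t [[v /= vS Avt] [w /= wS' Awt]].
have vw : v != w by apply: contraTneq wS' => <-; rewrite (disjointFr SS').
by have : (A v `&` A w) t by []; rewrite disjA.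
Qed.

Lemma cellsU (S S' : {set V}) : cells S `|` cells S' = cells (finset.setU S S').
Proof.
apply/seteqP; split=> t.
  by move=> [[v vS]|[v vS]] Av; exists v => //=; rewrite finset.in_setU (vS : is_true _) ?orbT.
by move=> [v /=]; rewrite finset.in_setU => /orP[] vS Av; [left|right]; exists v.
Qed.

Lemma ip_PH_cells (S S' : {set V}) : ip mu (\1_(cells S)) (P (\1_(cells S'))) =
  \sum_(v in S) \sum_(w in S') weight markovP mA v w.
Proof.
rewrite -[LHS]/(ip mu (chi mu (measurable_cells S))
  (PH (chi mu (measurable_cells S')))) !chi_cells ip_PH_step.
rewrite [RHS]big_mkcond; apply: eq_bigr => v _; case: ifP => _.
  rewrite [RHS]big_mkcond; apply: eq_bigr => w _; case: ifP => _.
    by rewrite !mulr1.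
  by rewrite !mulr0.
by rewrite big1// => w _; rewrite mul0r mulr0.
Qed.

Lemma mu_cells (S : {set V}) : fine (mu (cells S)) =
  \sum_(v in S) mass (weight markovP mA) v.
Proof.
rewrite -[in LHS](setIid (cells S)) -(ip_chi_chi mu (measurable_cells S) (measurable_cells S)).
rewrite chi_cells (ip_step markovP)// [RHS]big_mkcond; apply: eq_bigr => v _.
by case: ifP => _; rewrite ?mulr1 ?mulr0.
Qed.

End Cells.

Lemma cheeger_collection_of_system (k : nat) (eps : R) : (0 < k)%N -> 0 < eps ->
  exists2 delta, 0 < delta &
    (exists v, @S_system _ _ ipH (@simple_fun _ _ _ mu) PH1 (2 * k) delta v) ->
    exists A : nat -> set T, cheeger_collection mu k A /\
      forall i, (1 <= i <= k)%N ->
        1 - eps <= cheeger_ratio mu P (A i.*2.-1) (A i.*2).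
Proof.
case: k => // k _ eps0.
have [delta delta0 pairs] := disjoint_bipartite_pairs k.+1 eps0.
(* Halved because the edge energy is twice the form of [P + 1]. *)
exists (delta / 2) => [|[f [[of_ qf] sf]]]; first by rewrite divr_gt0.
have [V [X [A [mA [disjA sumA fE]]]]] := simple_partition sf.
pose p := weight markovP mA.
have p0 := weight_ge0 markovP mA; have psym := weight_sym markovP revP mA.
have [||B [C [BC BCd BCr]]] := pairs V p X p0 psym.
- by move=> i j; rewrite -of_ (fE i) (fE j) (ip_step markovP).
- move=> i; rewrite (energy_step markovP revP)// -fE.
  have := qf i; rewrite ip_PH1.
  by lra.
(* Index [2 j + 1] carries [B j] and index [2 j + 2] carries [C j]: collections count from 1, pairs
   from 0. *)
pose S q := (if odd q then B (inord q./2) else C (inord q./2.-1))%N.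
have SB j : S j.+1.*2.-1 = B (inord j).
  by rewrite /S doubleS /= odd_double /= uphalf_double.
have SC j : S j.+1.*2 = C (inord j).
  by rewrite /S doubleS /= odd_double /= doubleK.
have ratio (j : nat) : (j < k.+1)%N ->
   (1 - eps) * fine (mu (cells A (S j.+1.*2.-1) `|` cells A (S j.+1.*2))) <
   2 * ip mu (\1_(cells A (S j.+1.*2.-1))) (P (\1_(cells A (S j.+1.*2)))).
  move=> jk; rewrite SB SC cellsU (ip_PH_cells mA disjA) (mu_cells disjA sumA).
  exact: BCr.
have mass0 v : 0 <= mass p v by apply: sumr_ge0 => w _; exact: p0.
(* A pair of measure zero would have zero edge weight, against the strict inequality in [ratio]. *)
have mupos (j : nat) : (j < k.+1)%N ->
   0 < fine (mu (cells A (S j.+1.*2.-1) `|` cells A (S j.+1.*2))).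
  move=> jk; rewrite lt_def fine_ge0// andbT; apply/eqP => m0.
  have := ratio j jk; rewrite m0 mulr0; apply/negP; rewrite -leNgt.
  move: m0; rewrite SB SC cellsU (ip_PH_cells mA disjA) (mu_cells disjA sumA).
  set i := inord j => m0; rewrite pmulr_rle0//.
  rewrite -[leRHS]m0; apply: (@le_trans _ _ (\sum_(v in B i) mass p v)).
    apply: ler_sum => v _; rewrite /mass [leRHS](bigID (mem (C i)))/=.
    by rewrite lerDl sumr_ge0.
  rewrite [leRHS](big_setID (B i))/= finset.setUK lerDl.
  by apply: sumr_ge0.
have Sdisj a b : (1 <= a <= k.+1.*2)%N -> (1 <= b <= k.+1.*2)%N -> a <> b ->
    [disjoint S a & S b]%B.
  move=> ha hb ab.
  pose idx q := (if odd q then q./2 else q./2.-1)%N.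
  have idxk q : (1 <= q <= k.+1.*2)%N -> (idx q < k.+1)%N.
    by rewrite /idx; case: ifP => ? ?; lia.
  have SU q : S q \subset B (inord (idx q)) :|: C (inord (idx q)).
    by rewrite /S /idx; case: ifP => _; rewrite ?finset.subsetUl ?finset.subsetUr.
  have [e|ne] := eqVneq (inord (idx a) : 'I_k.+1) (inord (idx b)); last first.
    apply: (disjointWl (SU a)); apply: (disjointWr (SU b)); exact: BCd.
  have {e}e : idx a = idx b.
    by rewrite -(inordK (idxk _ ha)) e inordK// idxk.
  move: e; rewrite /idx /S; case: ifP => oa; case: ifP => ob e.
  - by exfalso; apply: ab; lia.
  - by rewrite e BC.
  - by rewrite -e disjoint_sym BC.
  - by exfalso; apply: ab; lia.
exists (fun q => cells A (S q)); split; first split; [|split|].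
- by move=> q _; exact: measurable_cells.
- by move=> a b ha hb ab; apply: (cells_disjoint disjA); exact: Sdisj.
- move=> [|j] //= jk; rewrite -[X in (_ < X)%E]fineK ?fin_num_measure//.
    by rewrite lte_fin; exact: mupos.
  by apply: measurableU; exact: measurable_cells.
- move=> [|j] //= jk; rewrite /cheeger_ratio ler_pdivlMr ?mupos//.
  by apply/ltW; exact: ratio.
Qed.

(** Positivity of [P] on [1 - (b + c)] gives [(b, P b) <= (b, b) - (b, P c)], and likewise for [c].
    Hence [(b - c, P (b - c)) <= m - 4 (b, P c)], and the ratio bound makes the form of [P + 1] at
    most [eps m]. *)
Lemma system_of_cheeger_collection (k : nat) (eps : R) (A : nat -> set T) :
  cheeger_collection mu k A ->
  (forall i, (1 <= i <= k)%N ->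
    1 - eps / 2 <= cheeger_ratio mu P (A i.*2.-1) (A i.*2)) ->
  exists f, @near_kernel_system _ _ ipH PH1 k eps f.
Proof.
move=> [mA [disjA posA]] ratioA.
have idx1 (i : 'I_k) : (1 <= i.+1.*2.-1 <= k.*2)%N by have := ltn_ord i; lia.
have idx2 (i : 'I_k) : (1 <= i.+1.*2 <= k.*2)%N by have := ltn_ord i; lia.
have idx (i : 'I_k) : (1 <= i.+1 <= k)%N by have := ltn_ord i.
pose b (i : 'I_k) := chi mu (mA _ (idx1 i)).
pose c (i : 'I_k) := chi mu (mA _ (idx2 i)).
pose m (i : 'I_k) := fine (mu (A i.+1.*2.-1 `|` A i.+1.*2)).
have disj p q (hp : (1 <= p <= k.*2)%N) (hq : (1 <= q <= k.*2)%N) : p <> q ->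
    ip mu (chi mu (mA p hp)) (chi mu (mA q hq)) = 0.
  by move=> pq; rewrite ip_chi_chi disjA// measure0.
have mE i : m i = ip mu (b i) (b i) + ip mu (c i) (c i).
  rewrite !ip_chi_chi !setIid /m measureU; last 3 first.
  - exact: (mA _ (idx1 i)).
  - exact: (mA _ (idx2 i)).
  - by apply: disjA.
  by rewrite fineD//; apply: fin_num_measure;
    [exact: (mA _ (idx1 i))|exact: (mA _ (idx2 i))].
have m0 i : 0 < m i.
  rewrite -lte_fin /m fineK; first exact: posA.
  by apply: fin_num_measure; apply: measurableU;
    [exact: (mA _ (idx1 i))|exact: (mA _ (idx2 i))].
have rest_ge0 i t : 0 <= (one mu - (b i + c i)) t.
  rewrite -[X in 0 <= X]/(1 - (\1_(A i.+1.*2.-1) t + \1_(A i.+1.*2) t)) !indicE.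
  have [/set_mem Ab|_] := boolP (t \in A i.+1.*2.-1);
    have [/set_mem Ac|_] := boolP (t \in A i.+1.*2); rewrite /=; try lra.
  have : (A i.+1.*2.-1 `&` A i.+1.*2) t by [].
  by rewrite disjA.
have self_le (h : H) i : (forall t, 0 <= h t) ->
    ip mu h (PH (b i)) + ip mu h (PH (c i)) <= ip mu h (one mu).
  move=> h0; have := ip_PH_ge0 markovP h0 (rest_ge0 i).
  by rewrite (ip_opB PHl) (ip_opD PHl) (PH_one markovP); lra.
exists (fun i => (Num.sqrt (m i))^-1 *: (b i - c i)); split=> [i j|i].
- rewrite (ipZl hip) (ipZr hip) (ipBl hip) !(ipBr hip).
  have [<-|ij] := eqVneq i j.
    rewrite /= [ip mu (b i) (c i)]disj// [ip mu (c i) (b i)]disj; last exact/nesym.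
    rewrite subr0 sub0r opprK -mE mulrA -expr2 exprVn sqr_sqrtr ?ltW// mulVf//.
    by rewrite gt_eqF.
  have nij : nat_of_ord i <> j by move=> /val_inj e; rewrite e eqxx in ij.
  rewrite [ip mu (b i) (b j)]disj; last lia.
  rewrite [ip mu (b i) (c j)]disj; last lia.
  rewrite [ip mu (c i) (b j)]disj; last lia.
  rewrite [ip mu (c i) (c j)]disj; last lia.
  by rewrite !subr0 !mulr0.
- rewrite (ipZl hip) (ip_opZ (PH1_lin markovP)) mulrA -expr2 exprVn.
  rewrite (sqr_sqrtr (ltW (m0 i))) ler_pdivrMl// ip_PH1.
  have b0 t : 0 <= b i t by exact: chi_ge0.
  have c0 t : 0 <= c i t by exact: chi_ge0.
  have bi := self_le (b i) i b0; have ci := self_le (c i) i c0.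
  have b1 : ip mu (b i) (one mu) = ip mu (b i) (b i).
    by rewrite ip_chi_one ip_chi_chi setIid.
  have c1 : ip mu (c i) (one mu) = ip mu (c i) (c i).
    by rewrite ip_chi_one ip_chi_chi setIid.
  have := ratioA _ (idx i); rewrite /cheeger_ratio ler_pdivlMr ?m0//.
  rewrite -/(m i) -[X in 2 * X]/(ip mu (b i) (PH (c i))) => hr.
  have mi := mE i.
  have sym := PH_sym markovP revP (c i) (b i).
  have x0 : ip mu (b i) (c i) = 0 by exact: disj.
  have y0 : ip mu (c i) (b i) = 0 by apply: disj; exact/nesym.
  rewrite (ip_opB PHl) (ipBl hip) (ipBl hip) (ipBl hip) !(ipBr hip) x0 y0.
  rewrite b1 in bi; rewrite c1 in ci.
  by lra.
Qed.

Lemma fredholm_of_shift (lam : R) :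
  fredholm_op ipH (fun f => PH1 f - (lam + 1) *: f) ->
  fredholm mu (fun f x => P f x - lam * f x).
Proof.
pose B (f : H) : H := PH1 f - (lam + 1) *: f.
have BE (f : H) : (fun x => P f x - lam * f x) = B f.
  apply/funext => x; rewrite -[RHS]/(P f x + f x - (lam + 1) * f x); ring.
move=> [[n [e ker]] clo [m [e' cof]]]; split.
- exists n, (fun i => (e i : H) : T -> R); split=> [i|f [hf]]; first exact: L2P.
  rewrite (BE (toL2 hf)) => Bf0.
  have [|c hc] := ker (toL2 hf).
    rewrite -/(B _) (@ip_ae_equal _ _ _ _ _ (B (toL2 hf)) (0 : H))//.
    + exact: (ip0r hip).
    + exact: L2P.
    + exact: L2P.
    + exact: L2P.
  exists c; have := ae_equal_of_null hc; apply: filterS => x /= ->.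
  by rewrite sum_LfunE.
- move=> u g hu hg ug.
  pose u' k := toL2 (hu k).
  have [|f hf] := clo u' (toL2 hg).
    have -> : (fun k => ip mu (PH1 (u' k) - (lam + 1) *: u' k - toL2 hg)
        (PH1 (u' k) - (lam + 1) *: u' k - toL2 hg)) =
        (fun k => norm2 mu (fun x => P (u k) x - lam * u k x - g x) ^+ 2).
      apply/funext => k; rewrite /norm2.
      have -> : (fun x => P (u k) x - lam * u k x - g x) =
          (B (u' k) - toL2 hg : H).
        by apply/funext => x; rewrite -[RHS]/(B (u' k) x - g x) -BE.
      by rewrite sqr_sqrtr// (ip_ge0 hip).
    have := cvgM ug ug; rewrite mulr0 => /(_ _); apply: cvg_trans.
    by apply: near_eq_cvg; apply: nearW => k /=; exact: expr2.
  exists f; split; first exact: L2P.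
  by rewrite BE; exact: ae_equal_of_null hf.
- exists m, (fun i => (e' i : H) : T -> R); split=> [i|g hg]; first exact: L2P.
  have [f [c hc]] := cof (toL2 hg).
  exists f, c; split; first exact: L2P.
  have := ae_equal_of_null hc; apply: filterS => x /= ->.
  have -> : P f x - lam * f x = B f x by rewrite -BE.
  by rewrite -[LHS]/(B f x + (\sum_i c i *: e' i) x) sum_LfunE.
Qed.

(** [PH1] is [P - (-1)], and the clause that fails is the finite codimension of its range. *)
Lemma not_fredholm_of_systems :
  (forall k delta, 0 < delta ->
     exists f, @near_kernel_system _ _ ipH PH1 k delta f) ->
  ~ fredholm mu (fun f x => P f x - (-1) * f x).
Proof.
move=> sys [_ _ [m [e [he cof]]]].
have nc := (near_kernel_not_cofinite (e := fun i => toL2 (he i)) hip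
  (@ip_geometrically_complete _ _ _ mu)
  (PH1_lin markovP) (PH1_sym markovP revP) (PH1_ge0 markovP revP)
  (PH1_le2 markovP revP) sys).
apply: nc => g.
have [f [c [hf gf]]] := cof g (L2P g).
exists (toL2 hf), c; apply: (ip_ext hip) => h.
rewrite !(ipC hip _ h); apply: ip_ae_equal; try exact: L2P.
apply: filterS gf => x ->.
rewrite -[RHS]/(P f x + f x + (\sum_i c i *: toL2 (he i)) x) sum_LfunE.
by rewrite mulN1r opprK.
Qed.

End Assembly.

Theorem theorem8p4 (d : measure_display) (T : measurableType d) (R : realType)
  (mu : probability T R) (P : (T -> R) -> (T -> R)) :
  L2_infinite_dim mu -> markov_operator mu P -> reversible mu P ->
  (-1 < lambda_ess_bar mu P <->
   (ereal_inf [set dual_cheeger mu P k | k in [set k : nat | (1 <= k)%N]]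
      < 1%E)%E).
Proof.
move=> _ markovP revP.
have hip := ip_semi_inner_product mu.
have cpl := @ip_geometrically_complete _ _ _ mu.
have [Al As A0 A2] := And4 (PH1_lin markovP) (PH1_sym markovP revP)
  (PH1_ge0 markovP revP) (PH1_le2 markovP revP).
have ess_ge (c : R) : (forall s, s < c ->
    fredholm_op (fun f g : LfunType mu (lee1n 2) => ip mu f g)
      (fun f => PH1 markovP f - s *: f)) ->
    lbound (ess_spectrum mu P) (-1 + c).
  move=> h lam; rewrite /ess_spectrum/= => nF; rewrite leNgt; apply/negP => lc.
  by apply: nF; apply: (fredholm_of_shift (markovP := markovP)); apply: h; lra.
split=> [ess|].
- rewrite ltNge; apply/negP => inf1; move: ess; apply/negP; rewrite -leNgt.
  (* -1 lies in the essential spectrum, whose infimum is genuine because it is bounded below. *)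
  apply: ge_inf.
    by exists (-1 + 0); apply: ess_ge => s s0; exact: negative_shift_fredholm.
  apply: (@not_fredholm_of_systems _ _ _ mu P markovP revP) => -[|k] delta delta0.
    by exists (fun=> 0); split; case.
  have : ((1 - delta / 2)%:E < dual_cheeger mu P k.+1)%E.
    apply: (@lt_le_trans _ _ 1%E); first by rewrite lte_fin; lra.
    by apply: (le_trans inf1); apply: ereal_inf_lbound; exists k.+1.
  case/ereal_sup_gt => _ [A cA <-] hA.
  apply: (system_of_cheeger_collection markovP revP cA) => i ik.
  rewrite -lee_fin; apply/ltW/(lt_le_trans hA).
  by apply: (@bigmin_le_mem _ _ (fun i =>
    (cheeger_ratio mu P (A i.*2.-1) (A i.*2))%:E)); rewrite mem_index_iota.
- case/ereal_inf_lt => _ [k /= k1 <-] hk.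
  (* The supremum is [-oo] when there is no admissible collection; [eps = 1] then serves. *)
  have [eps eps0 heps] : exists2 eps, 0 < eps &
      (dual_cheeger mu P k < (1 - eps)%:E)%E.
    case: (dual_cheeger mu P k) hk => [r| |]//.
      rewrite lte_fin => r1; exists ((1 - r) / 2); first by lra.
      by rewrite lte_fin; lra.
    by exists 1 => //; rewrite ltNyr.
  have [delta delta0 coll] := cheeger_collection_of_system markovP revP k1 eps0.
  have lb : lbound (ess_spectrum mu P) (-1 + delta / 2).
    apply: ess_ge => s sd.
    apply: (no_S_system_fredholm hip cpl _ _ Al As A0 A2 delta0 sd)
        => [a f g|f e|/coll[A [cA rA]]].
    + exact: simple_fun_lin.
    + exact: simple_dense.
    + move: heps; apply/negP; rewrite -leNgt.
      apply: (@le_trans _ _ (\big[Order.min/+oo%E]_(1 <= i < k.+1)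
          (cheeger_ratio mu P (A i.*2.-1) (A i.*2))%:E)%E).
        by apply: le_bigmin_nat => i ik; rewrite lee_fin rA.
      by apply: ereal_sup_ubound; exists A.
  have [e0|/set0P ne] := eqVneq (ess_spectrum mu P) set0.
  (* Junk value: the infimum of an empty essential spectrum is 0. *)
  + by rewrite /lambda_ess_bar e0 inf0 ltrN10.
  + by apply: (@lt_le_trans _ _ (-1 + delta / 2)); [lra|exact: lb_le_inf].
Qed.
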